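(* Let $(X,S)$ be a primitive association scheme. Suppose that $p$ is a prime which does not divide the Frame number $\mathrm{Fr}(X,S)$ of this scheme and that $m_{\min}>1$. Then $$|X|\le \frac{q^{m_{\min}}-1}{q-1},$$ where $q=p^{|\mathbb{Q}(X,S):\mathbb{Q}|}$.
   Context: An association scheme $(X,S)$ consists of a finite set $X$ and a partition $S$ of $X\times X$ closed under transposition, containing the diagonal $\Delta$, such that for $r,s,t\in S$ the number $c_{r,s}^t=|\{z:(x,z)\in r,(z,y)\in s\}|$ is independent of $(x,y)\in t$. The valency of $r\in S$ is $d_r=c_{r,r^*}^{\Delta}$ ($r^*$ the transpose). $S^*$ is the set of unions of subsets of $S$; the scheme is primitive if $|X|\ge2$ and every equivalence relation on $X$ in $S^*$ is $\Delta$ or $X\times X$. For a field $F$, the adjacency algebra $FS\subseteq \mathrm{Mat}_X(F)$ is the $F$-span of the $\{0,1\}$ adjacency matrices $A_s$, $s\in S$. The algebra $\mathbb{C}S$ is semisimple; let $\mathcal{P}$ be the set of its central primitive idempotents, and $P_0=\frac{1}{|X|}J$ the principal one ($J$ the all-one matrix). For $P\in\mathcal P$, let $L$ be an irreducible submodule of the standard module $\mathbb{C}X$ (column vectors indexed by $X$, acted on by $\mathbb{C}S$) corresponding to $P$; set $n_P=\dim_{\mathbb C}L$ (the degree) and $m_P=\operatorname{rk}(P)/n_P$ (the multiplicity). Put $m_{\min}=\min_{P\in\mathcal P\setminus\{P_0\}}m_P$. The Frame number is $\mathrm{Fr}(X,S)=|X|^{|S|}\prod_{r\in S}d_r\big/\prod_{P\in\mathcal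 P\setminus\{P_0\}}m_P^{n_P^2}$. Finally $\mathbb{Q}(X,S)=\mathbb{Q}(\{P_{x,y}: P\in\mathcal P,\ x,y\in X\})$ is the field generated over $\mathbb{Q}$ by all entries of all central primitive idempotents of $\mathbb{C}S$. *)

(* Defs.v *)
From HB Require Import structures.
From mathcomp Require Import all_boot all_order all_algebra.
From mathcomp Require Import boolp classical_sets functions cardinality fsbigop.
From mathcomp Require Import reals complex.

Set Implicit Arguments.
Unset Strict Implicit.
Unset Printing Implicit Defensive.

Import Order.TTheory GRing.Theory Num.Theory.

Local Open Scope ring_scope.

Section Schemes.
Variable X : finType.
Implicit Types (r s t E : {set X * X}) (S : {set {set X * X}}).

Definition diagonal_rel : {set X * X} := [set u | u.1 == u.2].

Definition transpose r : {set X * X} := [set u | (u.2, u.1) \in r].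

Definition paths r s (x y : X) : nat :=
  #|[set z | ((x, z) \in r) && ((z, y) \in s)]|.

Record association_scheme S : Prop := AssociationScheme {
  scheme_partition : finset.partition S [set: X * X];
  scheme_transpose : forall s, s \in S -> transpose s \in S;
  scheme_diagonal : diagonal_rel \in S;
  scheme_regular : forall r s t, r \in S -> s \in S -> t \in S ->
    forall u v, u \in t -> v \in t -> paths r s u.1 u.2 = paths r s v.1 v.2
}.

(* c_{r,s}^t, evaluated at an arbitrary pair of t; 0 when t is empty, which
   does not happen for a member of a scheme. *)
Definition intersection_number r s t : nat :=
  if [pick u in t] is Some u then paths r s u.1 u.2 else 0%N.

Definition valency r : nat := intersection_number r (transpose r) diagonal_rel.

Definition unions S : {set {set X * X}} := [set finset.cover T | T in powerset S].

Definition primitive_scheme S : Prop :=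
  (2 <= #|X|)%N /\
  forall E, E \in unions S -> equivalence_rel (fun x y => (x, y) \in E) ->
    E = diagonal_rel \/ E = [set: X * X].

(* Matrices indexed by X are matrices indexed by 'I_#|X|, along enum_val. *)
Definition adjacency_matrix (F : fieldType) s : 'M[F]_#|X| :=
  \matrix_(i, j) ((enum_val i, enum_val j) \in s)%:R.

(* Row spaces of mxvec-encoded matrices, as for the matrix algebras of
   mxalgebra: membership is (A \in adjacency_algebra F S)%MS. *)
Definition adjacency_algebra (F : fieldType) S : 'A[F]_#|X| :=
  (\sum_(s in S) <<mxvec (adjacency_matrix F s)>>)%MS.

End Schemes.

Section Idempotents.
Variables (C : numClosedFieldType) (X : finType) (S : {set {set X * X}}).
Implicit Types e f P : 'M[C]_#|X|.

Definition central_idempotent e : Prop :=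
  (e \in 'Z(adjacency_algebra C S))%MS /\ e *m e = e.

Definition central_primitive_idempotents : set 'M[C]_#|X| :=
  [set P | [/\ central_idempotent P, P != 0 &
     forall e f, central_idempotent e -> central_idempotent f ->
       e *m f = 0 -> P = e + f -> e = 0 \/ f = 0]]%classic.

Definition principal_idempotent : 'M[C]_#|X| := const_mx (#|X|%:R^-1).

Definition nonprincipal_idempotents : set 'M[C]_#|X| :=
  (central_primitive_idempotents `\ principal_idempotent)%classic.

(* A subspace of the column vectors is the row space of a matrix whose rows are
   the transposes of its vectors; A acts on these rows as right multiplication
   by A^T. *)
Definition submodule (L : 'M[C]_#|X|) : Prop :=
  forall A, (A \in adjacency_algebra C S)%MS -> stablemx L A^T.

Definition irreducible_submodule (L : 'M[C]_#|X|) : Prop :=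
  [/\ submodule L, L != 0 &
      forall U : 'M[C]_#|X|, submodule U -> (U <= L)%MS -> U != 0 -> (L <= U)%MS].

(* L corresponds to P when P acts on L as the identity. *)
Definition corresponds (L P : 'M[C]_#|X|) : Prop := L *m P^T = L.

(* n_P: all the irreducible submodules corresponding to P are isomorphic. *)
Definition idempotent_degree P : nat :=
  xget 0%N [set n | exists L : 'M[C]_#|X|,
    [/\ irreducible_submodule L, corresponds L P & \rank L = n]]%classic.

(* m_P: the standard module has an n_P-dimensional summand for each of the m_P
   copies, so the division of naturals is exact. *)
Definition multiplicity P : nat := (\rank P %/ idempotent_degree P)%N.

Definition min_multiplicity : nat :=
  xget 0%N [set m | (exists2 P, nonprincipal_idempotents P & multiplicity P = m) /\
    (forall P, nonprincipal_idempotents P -> (m <= multiplicity P)%N)]%classic.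

Definition frame_number : rat :=
  (#|X| ^ #|S| * \prod_(r in S) valency r)%N%:R /
  \big[*%R/1]_(P \in nonprincipal_idempotents)
     ((multiplicity P)%:R : rat) ^+ (idempotent_degree P ^ 2)%N.

Definition idempotent_entries : set C :=
  [set z | exists P i j, central_primitive_idempotents P /\ z = P i j]%classic.

(* Q(X,S): the least subfield of C containing the entries. *)
Definition scheme_field : set C :=
  smallest (fun K : set C => GRing.divring_closed (mem K)) idempotent_entries.

End Idempotents.

Arguments scheme_field C {X} S _.

Definition rat_basis (C : numClosedFieldType) (K : set C) (d : nat)
    (e : 'I_d -> C) : Prop :=
  (forall i, K (e i)) /\
  forall z, K z -> exists! a : 'rV[rat]_d, z = \sum_i ratr (a 0 i) * e i.

(* |K : Q| for a subfield K of C; the value is 0 when K has infinite degree. *)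
Definition degree_over_rat (C : numClosedFieldType) (K : set C) : nat :=
  xget 0%N [set d | exists e : 'I_d -> C, rat_basis K e]%classic.

(* Main.v *)
(** If [a] is a nonzero matrix in the adjacency algebra [FS] over a field [F],
    then "the columns [x] and [y] of [a] are proportional" is an equivalence
    relation on [X] which is a union of members of [S].  By primitivity, as soon
    as [a] has rank [m >= 2] its columns are pairwise non-proportional nonzero
    vectors of an [m]-dimensional space, so for [F] finite
    [#|X| * (#|F| - 1) <= #|F| ^ m - 1].  Such an [a] of rank [m_P], over a field
    with at most [p ^ |Q(X,S) : Q|] elements, is obtained by reduction.

    Let [V] be a valuation ring of [C] in which [p] is not invertible.  In each
    block [P CS], the matrix units [u_i v_j] can be chosen so that every [A_s] has
    coefficients in [V].  Comparing the Gram matrix of the form [tr (A B^T)] on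
    the basis [A_s] and on the matrix units shows that [Fr(X,S) = det T * det T']
    for two matrices over [V]; hence [Fr(X,S)] lies in [V] for all primes, i.e. is an
    integer, and if [p] does not divide it, then [T] is invertible over [V], so that
    the matrix units have entries in [V].  They reduce to matrix units over the
    residue field [k] of [V], whereas [P] reduces to a matrix over the residue field
    [F] of [Q(X,S)], which is finite.  The block of [FS] cut out by the reduction of
    [P] becomes a full matrix algebra over [k]; by Wedderburn's little theorem it
    contains an idempotent that is primitive over [k], of rank [m_P]. *)

(* The obstacle is that the matrix units of a block are defined only over a splitting field, whose
   residue field may be much larger than the bound allows; only the central idempotent has its
   entries in Q(X,S). The two are reduced separately: the units, over [k], show that the reduced
   block is still a full matrix algebra whose primitive idempotents have rank m_P, and the
   idempotent cuts out a form of that block over [F]. A priori this form could be a matrix algebra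
   over a noncommutative division algebra, and rank m_P would not occur over [F]; finiteness
   excludes this. Taking V in the whole of C avoids the choice of a splitting field and of a prime
   in it. V is not Noetherian, but only finitely generated lattices occur. The exponent |Q(X,S) : Q|
   comes from scaling: a rational relation between elements of Q(X,S) in V, divided by its dominant
   coefficient, reduces to a nontrivial relation over the prime field. The Frame number appears
   because the trace form has the diagonal Gram matrix |X| d_s on the A_s, while it pairs the unit
   (i, j) with (j, i), with value m_P, in each block. *)
Require Import Defs.
From HB Require Import structures.
From mathcomp Require Import all_boot all_order all_algebra all_field ring_quotient.
From mathcomp Require Import boolp classical_sets functions cardinality fsbigop.
From mathcomp Require Import reals complex.
From mathcomp Require Import ring.

Set Implicit Arguments.
Unset Strict Implicit.
Unset Printing Implicit Defensive.

Import Order.TTheory GRing.Theory Num.Theory.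

Local Open Scope ring_scope.

(** * Valuation rings *)

(** Subrings are plain sets, so that Zorn's lemma can range over them; a ring structure is put on
    one only when its residue field is formed. *)
Record subring_set (C : fieldType) (V : set C) : Prop := SubringSet {
  subring1 : V 1;
  subringB : forall x y, V x -> V y -> V (x - y);
  subringM : forall x y, V x -> V y -> V (x * y) }.

Section SubringTheory.
Variables (C : fieldType) (V : set C).
Hypothesis hV : subring_set V.

Lemma subring0 : V 0.
Proof. by rewrite -(subrr 1); apply: (subringB hV); apply: (subring1 hV). Qed.

Lemma subringN x : V x -> V (- x).
Proof. by move=> hx; rewrite -sub0r; apply: (subringB hV) => //; apply: subring0. Qed.

Lemma subringD x y : V x -> V y -> V (x + y).
Proof. by move=> hx hy; rewrite -(opprK y); apply: (subringB hV) => //; apply: subringN. Qed.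

Lemma subring_sum (I : Type) (r : seq I) (P : pred I) (F : I -> C) :
  (forall i, P i -> V (F i)) -> V (\sum_(i <- r | P i) F i).
Proof. by move=> h; apply: big_ind => //; [apply: subring0 | apply: subringD]. Qed.

Lemma subring_prod (I : Type) (r : seq I) (P : pred I) (F : I -> C) :
  (forall i, P i -> V (F i)) -> V (\prod_(i <- r | P i) F i).
Proof. by move=> h; apply: big_ind => //; [apply: (subring1 hV) | apply: (subringM hV)]. Qed.

Lemma subringX x n : V x -> V (x ^+ n).
Proof.
by move=> hx; elim: n => [|n IHn]; rewrite ?expr0 ?exprS;
  [apply: (subring1 hV)|apply: (subringM hV)].
Qed.

Lemma subring_nat n : V n%:R.
Proof.
by elim: n => [|n IHn]; rewrite ?mulrS; [apply: subring0|apply: subringD => //;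
  apply: (subring1 hV)].
Qed.

Lemma subring_int (z : int) : V z%:~R.
Proof.
by case: z => n; rewrite ?NegzE ?mulrNz; [|apply: subringN]; apply: subring_nat.
Qed.

Lemma subring_det n (A : 'M[C]_n) : (forall i j, V (A i j)) -> V (\det A).
Proof.
move=> hA; apply: subring_sum => s _; apply: (subringM hV); last by apply: subring_prod.
by apply: subringX; apply: subringN; apply: (subring1 hV).
Qed.

Definition poly_over (f : {poly C}) := forall i, V f`_i.

Lemma poly_over_horner f x : poly_over f -> V x -> V f.[x].
Proof.
move=> hf hx; rewrite horner_coef; apply: subring_sum => i _.
by apply: (subringM hV) => //; apply: subringX.
Qed.

Lemma poly_overM f g : poly_over f -> poly_over g -> poly_over (f * g).
Proof. by move=> hf hg i; rewrite coefM; apply: subring_sum => j _; apply: (subringM hV). Qed.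

Lemma poly_overC c : V c -> poly_over c%:P.
Proof. by move=> hc i; rewrite coefC; case: ifP => _ //; apply: subring0. Qed.

Lemma poly_overXn n : poly_over 'X^n.
Proof. by move=> i; rewrite coefXn; apply: subring_nat. Qed.

Lemma adjoin_subring x :
  subring_set [set z | exists2 f, poly_over f & z = f.[x]]%classic.
Proof.
split=> [|z t [f hf ->] [g hg ->]|z t [f hf ->] [g hg ->]].
- by exists 1; rewrite ?hornerC // -polyC1; apply/poly_overC/(subring1 hV).
- by exists (f - g); rewrite ?hornerD ?hornerN // => i; rewrite coefB; apply: (subringB hV).
- by exists (f * g); rewrite ?hornerM //; apply: poly_overM.
Qed.

End SubringTheory.

Record valuation_ring (C : fieldType) (V : set C) : Prop := ValuationRing {
  valuation_subring :> subring_set V;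
  valuation_total : forall x, V x \/ V x^-1 }.

Section ValuationExistence.
Variables (C : numFieldType) (p : nat).
Hypothesis p_prime : prime p.
Local Notation pC := (p%:R : C).

Lemma pC_neq0 : pC != 0.
Proof. by rewrite pnatr_eq0 -lt0n prime_gt0. Qed.

Lemma int_subring_noninv :
  subring_set [set x : C | exists z : int, x = z%:~R]%classic /\
  ~ [set x : C | exists z : int, x = z%:~R]%classic pC^-1.
Proof.
split; first split=> [|x y [a ->] [b ->]|x y [a ->] [b ->]].
- by exists 1.
- by exists (a - b); rewrite rmorphB.
- by exists (a * b); rewrite rmorphM.
move=> [z hz]; have: (z * p%:Z)%:~R = 1 :> C by rewrite rmorphM /= -hz mulVf ?pC_neq0.
move/eqP; rewrite -[1]/(1%:~R) eqr_int => /eqP h.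
have : (p%:Z %| 1)%Z by apply/dvdzP; exists z.
by rewrite dvdz1 absz_nat => /eqP hp; move: p_prime; rewrite hp.
Qed.

Section Maximal.
Variable V : set C.
Hypotheses (hV : subring_set V) (hpV : ~ V pC^-1).
Hypothesis Vmax : forall W : set C, subring_set W -> (V `<=` W)%classic ->
  ~ W pC^-1 -> W = V.

Lemma maximal_adjoin x : ~ V x -> exists2 f, poly_over V f & pC^-1 = f.[x].
Proof.
move=> hx; pose W := [set z | exists2 f, poly_over V f & z = f.[x]]%classic.
case: (pselect (W pC^-1)) => [//|hW]; exfalso; apply: hx.
rewrite -(@Vmax W) //; first by exists 'X; rewrite ?hornerX // -['X]expr1; apply: poly_overXn.
- exact: adjoin_subring.
- by move=> z hz; exists z%:P; rewrite ?hornerC //; apply: poly_overC.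
Qed.

(** If [u = 1 - p a] had no inverse in V, maximality would give [1 / p = f(1 / u)]. Clearing
    denominators puts [u ^ N / p] in V, and [u ^ N] is 1 minus a multiple of [p] in V, so [1 / p]
    itself would lie in V. *)
Lemma maximal_unit a : V a -> 1 - pC * a != 0 /\ V (1 - pC * a)^-1.
Proof.
move=> ha; set u := 1 - _.
have hpa c : V c -> 1 = pC * c -> False.
  move=> hc h; apply: hpV; suff -> : pC^-1 = c by [].
  by apply: (mulfI pC_neq0); rewrite mulfV ?pC_neq0.
have u0 : u != 0 by apply/eqP => /eqP; rewrite subr_eq0 => /eqP /hpa; apply.
have hu : V u.
  apply: (subringB hV); first exact: (subring1 hV).
  by apply: (subringM hV) => //; apply: subring_nat.
split=> //; case: (pselect (V u^-1)) => // /maximal_adjoin [f hf hfu].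
pose N := (size f).-1.
have h1 : V (u ^+ N * pC^-1).
  rewrite hfu horner_coef mulr_sumr; apply: subring_sum => // i _.
  have hi : (i <= N)%N by rewrite /N -ltnS (ltn_predK (ltn_ord i)).
  rewrite mulrCA exprVn -[in X in _ * X](subnK hi) exprD mulfK ?expf_neq0 //.
  by apply: (subringM hV) => //; apply: subringX.
have [c hc huN] : exists2 c, V c & u ^+ N = 1 - pC * c.
  elim: (N) => [|n [c hc IHn]]; first by exists 0; rewrite ?expr0 ?mulr0 ?subr0 //; apply: subring0.
  exists (c + a - pC * a * c).
    apply: (subringB hV); first exact: subringD.
    by do 2!apply: (subringM hV) => //; apply: subring_nat.
  by rewrite exprS IHn /u; ring.
exfalso; apply: hpV; have -> : pC^-1 = u ^+ N * pC^-1 + c.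
  by rewrite huN mulrBl mul1r mulrAC mulfV ?pC_neq0 // mul1r subrK.
exact: subringD.
Qed.

(* [V[x]] contains [1 / p] through a polynomial of degree less than [n].  If
   this also holds for [1 / x], the relation for the smaller degree lowers the
   degree of the other one. *)
Definition relation_of_size x n :=
  exists f : {poly C}, [/\ poly_over V f, (size f <= n)%N & pC * f.[x] = 1].

Lemma relation_descent x n m : x != 0 -> (m <= n)%N ->
  relation_of_size x n.+1 -> relation_of_size x^-1 m.+1 -> relation_of_size x n.
Proof.
move=> x0 le_mn [f [hf sf fx]] [g [hg sg gx]].
have [u0 hu] := maximal_unit (hg 0%N).
set u := 1 - _ in u0 hu.
pose h := \poly_(i < m) (u^-1 * g`_(m - i)).
have hh : poly_over V h.
  move=> i; rewrite coef_poly; case: ifP => _; last exact: subring0.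
  exact: (subringM hV).
(* The relation for [1 / x] says that [1 - p g_0] is [p] times a combination of negative powers of
   [x]. As [1 - p g_0] is a unit of V, multiplying by [x ^ m] makes [x ^ m] equal to [p] times a
   polynomial of smaller degree, which then replaces the leading term of the relation for [x]. *)
have xm : x ^+ m = pC * h.[x].
  have e1 : u = pC * \sum_(1 <= j < m.+1) g`_j * x ^- j.
    have: pC * \sum_(0 <= j < m.+1) g`_j * x ^- j = 1.
      rewrite -[RHS]gx (horner_coef_wide _ sg) big_mkord; congr (_ * _).
      by apply: eq_bigr => j _; rewrite exprVn.
    rewrite big_nat_recl // expr0 invr1 mulr1 mulrDr => e.
    rewrite /u -[X in X - _]e addrAC subrr add0r; congr (_ * _).
    by rewrite big_add1.
  apply: (mulfI u0); rewrite {1}e1 horner_poly mulrCA; rewrite -!mulrA; congr (_ * _).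
  rewrite mulr_suml mulr_sumr big_add1 big_mkord (reindex_inj rev_ord_inj) /=.
  apply: eq_bigr => i _.
  rewrite subnSK // mulrA (mulrA u) mulfV // mul1r -mulrA; congr (_ * _).
  have hi := ltnW (ltn_ord i).
  by rewrite -[in x ^+ m](subnK hi) exprD mulrA mulVf ?mul1r // expf_neq0.
exists (\poly_(i < n) f`_i + (pC * f`_n)%:P * (h * 'X^(n - m))); split.
- move=> i; rewrite coefD; apply: subringD => //.
    by rewrite coef_poly; case: ifP => _ //; apply: subring0.
  apply: poly_overM => //; last by apply: poly_overM => //; apply: poly_overXn.
  by apply: poly_overC => //; apply: (subringM hV) => //; apply: subring_nat.
- rewrite (leq_trans (size_polyD _ _)) // geq_max size_poly /=.
  rewrite mul_polyC (leq_trans (size_scale_leq _ _)) //.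
  rewrite (leq_trans (size_polyMleq _ _)) // size_polyXn addnS /=.
  by rewrite -[leqRHS](subnKC le_mn) leq_add2r size_poly.
- rewrite hornerD !hornerM !hornerC hornerXn -[RHS]fx; congr (_ * _).
  rewrite (horner_coef_wide _ sf) big_ord_recr /= horner_poly; congr (_ + _).
  have -> : x ^+ n = pC * h.[x] * x ^+ (n - m) by rewrite -xm -exprD subnKC.
  by ring.
Qed.

Lemma maximal_total x : V x \/ V x^-1.
Proof.
case: (pselect (V x)) => hx; first by left.
case: (pselect (V x^-1)) => hxV; first by right.
have x0 : x != 0 by apply/eqP => h; apply: hx; rewrite h; apply: subring0.
have hr y : ~ V y -> exists n, `[< relation_of_size y n >].
  move=> /maximal_adjoin [f hf e]; exists (size f); apply/asboolP; exists f.
  by rewrite -e mulfV ?pC_neq0.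
have r0 y : ~ relation_of_size y 0.
  move=> [f [_]]; rewrite leqn0 size_poly_eq0 => /eqP -> /eqP.
  by rewrite horner0 mulr0 eq_sym oner_eq0.
case: (ex_minnP (hr _ hx)) => [[/asboolP/r0//|n]] /asboolP hn nmin.
case: (ex_minnP (hr _ hxV)) => [[/asboolP/r0//|m]] /asboolP hm mmin.
case: (leqP m n) => hmn; exfalso.
  have /asboolP/nmin := relation_descent x0 hmn hn hm.
  by rewrite ltnn.
have h' : relation_of_size x^-1^-1 n.+1 by rewrite invrK.
have /asboolP/mmin := relation_descent (invr_neq0 x0) (ltnW hmn) hm h'.
by rewrite ltnn.
Qed.

End Maximal.

(* By Zorn, a subring maximal among those not containing [1 / p]; its
   maximality makes it a valuation ring. *)
Lemma valuation_ring_exists :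
  exists2 V : set C, valuation_ring V & ~ V pC^-1.
Proof.
pose P := [set W : set C | W = set0 \/ (subring_set W /\ ~ W pC^-1)]%classic.
have [F hF hFtot|V [PV Vmax]] := @Zorn_bigcup C P.
  case: (pselect (exists2 W, F W & W !=set0)%classic) => [[W0 FW0 W0n]|hn]; last first.
    left; rewrite -subset0 => x [W FW Wx]; apply: hn; exists W => //; by exists x.
  right; have good W : F W -> (W !=set0)%classic -> subring_set W /\ ~ W pC^-1.
    by move=> /hF [->|//] [].
  have [sW0 _] := good _ FW0 W0n.
  have two x y : (\bigcup_(X in F) X)%classic x -> (\bigcup_(X in F) X)%classic y ->
      exists W, [/\ F W, W x, W y & subring_set W].
    move=> [W1 F1 x1] [W2 F2 y2]; case: (hFtot _ _ F1 F2) => h.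
      by exists W2; split=> //; [apply: h | apply: (good W2 F2 _).1; exists y].
    by exists W1; split=> //; [apply: h | apply: (good W1 F1 _).1; exists x].
  split; first split=> [|x y hx hy|x y hx hy].
  - by exists W0 => //; apply: (subring1 sW0).
  - by have [W [FW Wx Wy sW]] := two _ _ hx hy; exists W => //; apply: (subringB sW).
  - by have [W [FW Wx Wy sW]] := two _ _ hx hy; exists W => //; apply: (subringM sW).
  - by move=> [W FW Wp]; apply: (good W FW _).2 => //; exists pC^-1.
have [Zs Zp] := int_subring_noninv.
have [sV hpV] : subring_set V /\ ~ V pC^-1.
  case: PV => // V0; exfalso.
  apply: (Vmax [set x : C | exists z : int, x = z%:~R]%classic); last by right.
  rewrite V0; split; first exact: sub0set.
  by move=> /(_ 0); apply; exists 0.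
exists V => //; split=> // x; apply: maximal_total => // W sW VW Wp.
apply: contrapT => nWV; apply: (Vmax W); last by right.
by split=> // WV; apply: nWV; apply/seteqP; split.
Qed.

End ValuationExistence.

(** * The residue field of a valuation ring *)

Section ResidueField.
Variables (C : fieldType) (V : set C) (hV : valuation_ring V).

(** The proof of [valuation_ring V] is an argument, so that the closure instances are inferred from
    the predicate itself; [domain_pred] and [residue_subfield_pred] follow the same pattern. *)
Definition valuation_pred of valuation_ring V : {pred C} := fun x => `[< V x >].
Local Notation Vp := (valuation_pred hV).

Lemma valuation_predP x : reflect (V x) (x \in Vp).
Proof. exact: asboolP. Qed.

Lemma valuation_pred_subring : subring_closed Vp.
Proof.
split=> [|x y|x y]; first by apply/valuation_predP/(subring1 hV).
- by move=> /valuation_predP hx /valuation_predP hy; apply/valuation_predP/(subringB hV).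
- by move=> /valuation_predP hx /valuation_predP hy; apply/valuation_predP/(subringM hV).
Qed.
HB.instance Definition _ :=
  GRing.isSubringClosed.Build C (valuation_pred hV) valuation_pred_subring.

Record valuation_type := ValuationType { vval : C; _ : vval \in Vp }.
HB.instance Definition _ := [isSub for vval].
HB.instance Definition _ := [Choice of valuation_type by <:].
HB.instance Definition _ := [SubChoice_isSubComNzRing of valuation_type by <:].

Definition nonunit_pred : {pred valuation_type} :=
  fun x => `[< ~ exists y, y * x = 1 >].

(** Of two elements of a valuation ring one divides the other, and hence divides every combination
    of both; a divisor of a unit is a unit. *)
Lemma nonunit_ideal : idealr_closed nonunit_pred.
Proof.
split.
- by apply/asboolP => -[y]; rewrite mulr0 => /eqP; rewrite eq_sym oner_eq0.
- by apply/negP => /asboolP; apply; exists 1; rewrite mulr1.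
move=> a u v /asboolP hu /asboolP hv; apply/asboolP => -[y hy].
have [t [hut|hvt]] : exists t : valuation_type, u = t * v \/ v = t * u.
  have [v0|v0] := eqVneq (val v) 0.
    by exists 0; right; apply: val_inj; rewrite /= v0 mul0r.
  have [u0|u0] := eqVneq (val u) 0.
    by exists 0; left; apply: val_inj; rewrite /= u0 mul0r.
  case: (valuation_total hV (val u / val v)) => [ht|].
    have /valuation_predP ht' := ht.
    by exists (ValuationType ht'); left; apply: val_inj; rewrite /= divfK.
  rewrite invf_div => ht; have /valuation_predP ht' := ht.
  by exists (ValuationType ht'); right; apply: val_inj; rewrite /= divfK.
- by apply: hv; exists (y * (a * t + 1)); rewrite -[RHS]hy hut; ring.
- by apply: hu; exists (y * (a + t)); rewrite -[RHS]hy hvt; ring.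
Qed.
HB.instance Definition _ := isIdealr.Build valuation_type nonunit_pred nonunit_ideal.

Definition residue_type := {ideal_quot nonunit_pred}.
HB.instance Definition _ := GRing.ComNzRing.on residue_type.
Local Open Scope quotient_scope.

Lemma residue_eq0 (x : valuation_type) :
  (\pi x == 0 :> residue_type) = (x \in nonunit_pred).
Proof. by rewrite -[x in RHS]subr0 Quotient.idealrBE; congr (_ == _); rewrite piE. Qed.

Definition residue_inv (x : residue_type) : residue_type :=
  if x == 0 then 0 else xget 0 [set y | y * x = 1]%classic.

Lemma residue_mulVf x : x != 0 -> residue_inv x * x = 1.
Proof.
move=> x0; rewrite /residue_inv (negPf x0).
apply: (@xgetPex _ 0 [set y | y * x = 1]%classic).
move: x0; rewrite -[x]reprK residue_eq0 => /asboolP/contrapT [y hy].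
by exists (\pi y); rewrite /= -[LHS]rmorphM hy rmorph1.
Qed.

Lemma residue_inv0 : residue_inv 0 = 0.
Proof. by rewrite /residue_inv eqxx. Qed.

HB.instance Definition _ :=
  GRing.ComNzRing_isField.Build residue_type residue_mulVf residue_inv0.

(** The interface used for reduction: a matrix over V is lifted to [O], read in C through [map_mx i]
    and reduced through [map_mx f]. *)
Lemma residue_field_exists :
  exists (O : comNzRingType) (i : {rmorphism O -> C})
         (k : fieldType) (f : {rmorphism O -> k}),
    [/\ injective i, forall x, V x <-> exists o, i o = x,
        forall y, exists o, f o = y &
        forall o, f o != 0 -> exists o', o' * o = 1].
Proof.
exists valuation_type, (val : {rmorphism valuation_type -> C}).
exists residue_type, (\pi_residue_type : {rmorphism valuation_type -> residue_type}).
split.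
- exact: val_inj.
- move=> x; split=> [hx|[o <-]]; last by apply/valuation_predP/valP.
  by have /valuation_predP hx' := hx; exists (ValuationType hx').
- by move=> y; exists (repr y); apply: reprK.
- by move=> o; rewrite residue_eq0 => /asboolP/contrapT.
Qed.
End ResidueField.

(** * Lattices over a valuation ring and linear algebra *)

Section ValuationLattice.
Variables (C : fieldType) (V : set C) (hV : valuation_ring V).

(** [x] plays the role of an element of least valuation; totality of divisibility replaces a value
    group. *)
Lemma valuation_dominant (s : seq C) : has (fun x => x != 0) s ->
  exists2 x, x \in s /\ x != 0 & forall y, y \in s -> V (y / x).
Proof.
elim: s => //= a s IHs; have [a0 /=|a0 _] := eqVneq a 0.
  move=> /IHs [x [xs x0] hx]; exists x; first by rewrite inE xs orbT.
  by move=> y; rewrite inE => /predU1P[->|/hx//]; rewrite a0 mul0r; apply: (subring0 hV).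
have Vaa : V (a / a) by rewrite divff //; apply: (subring1 hV).
case hs: (has (fun x => x != 0) s); last first.
  exists a; first by rewrite inE eqxx.
  move=> y; rewrite inE => /predU1P[->//|ys].
  have /negbT/hasPn/(_ y ys) := hs; rewrite negbK => /eqP ->.
  by rewrite mul0r; apply: (subring0 hV).
have [x [xs x0] hx] := IHs hs.
case: (valuation_total hV (a / x)) => hax.
  by exists x; [rewrite inE xs orbT|move=> y; rewrite inE => /predU1P[->|/hx]].
rewrite invf_div in hax; exists a; first by rewrite inE eqxx.
move=> y; rewrite inE => /predU1P[->//|/hx hyx].
have -> : y / a = (y / x) * (x / a) by rewrite mulrA divfK.
exact: (subringM hV).
Qed.

(* The lattice spanned by finitely many vectors over a valuation ring is free: in
   a linear relation, the vector with the dominant coefficient is redundant. *)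
Lemma valuation_subbasis (I : finType) (W : lmodType C) (w : I -> W) :
  exists T : {set I},
    (forall s, exists2 c : I -> C, forall t, V (c t) & w s = \sum_(t in T) c t *: w t) /\
    (forall c : I -> C, \sum_(t in T) c t *: w t = 0 -> forall t, t \in T -> c t = 0).
Proof.
pose spans (T : {set I}) :=
  forall s, exists2 c : I -> C, forall t, V (c t) & w s = \sum_(t in T) c t *: w t.
have spansT : `[< spans [set: I] >].
  apply/asboolP => s; exists (fun t => (t == s)%:R) => [t|]; first exact: (subring_nat hV).
  rewrite (bigD1 s) //= eqxx scale1r big1 ?addr0 // => t /andP[_ /negPf ->].
  by rewrite scale0r.
case: (@arg_minnP _ [set:
  I] (fun T => `[< spans T >]) (fun T => #|T|) spansT) => T /asboolP hT Tmin.
exists T; split=> // c hc t0 Tt0; apply: contrapT => /eqP ct0.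
have /valuation_dominant [x [/mapP [j]]] : has (fun x => x != 0) [seq c t | t <- enum T].
  by apply/hasP; exists (c t0) => //; apply/map_f; rewrite mem_enum.
rewrite mem_enum => Tj -> cj0 hdom.
have wj : w j = \sum_(t in T :\ j) - (c t / c j) *: w t.
  move: hc; rewrite (big_setD1 j) //= => /eqP; rewrite addr_eq0 => /eqP hc.
  apply: (scalerI cj0); rewrite hc scaler_sumr -sumrN; apply: eq_bigr => t _.
  by rewrite scalerA mulrN mulrCA mulfV // mulr1 scaleNr.
suff /Tmin : `[< spans (T :\ j) >] by rewrite (cardsD1 j T) Tj ltnn.
apply/asboolP => s; have [d hd ->] := hT s.
exists (fun t => if t \in T then d t - d j * (c t / c j) else 0).
  move=> t; case: ifP => [Tt|_]; last exact: (subring0 hV).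
  apply: (subringB hV) => //; apply: (subringM hV) => //; apply: hdom.
  by apply/map_f; rewrite mem_enum.
rewrite (big_setD1 j) //= wj scaler_sumr -big_split; apply: eq_bigr => t /=.
by rewrite inE => /andP[_ ->]; rewrite scalerA -scalerDl mulrN addrC.
Qed.

End ValuationLattice.

(** * Nilpotent matrices, eigenvalues and ranks *)

Lemma poly_monic_dvd_Xn (F : fieldType) (q : {poly F}) n :
  q \is monic -> q %| 'X^n -> q = 'X^((size q).-1).
Proof.
move=> qm; rewrite -['X]subr0 => /dvdp_exp_XsubCP[k _]; rewrite subr0 => hq.
have -> : q = 'X^k by apply/eqP; rewrite -eqp_monic ?monicXn.
by rewrite size_polyXn.
Qed.

(** As [M ^+ l = 0], the matrix ['X%:M - M] divides the scalar matrix of ['X^l]; by determinants,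
    the characteristic polynomial divides a power of ['X]. *)
Lemma char_poly_nilpotent (F : fieldType) n (M : 'M[F]_n) l :
  M ^+ l = 0 -> char_poly M = 'X^n.
Proof.
move=> Ml; pose P := map_mx (@polyC F) M.
have Pl : P ^+ l = 0.
  suff -> : P ^+ l = map_mx (@polyC F) (M ^+ l) by rewrite Ml map_mx0.
  elim: l {Ml} => [|l IHl]; first by rewrite !expr0 map_mx1.
  by rewrite !exprS IHl -!mulmxE map_mxM.
have cXP : GRing.comm ('X%:M : 'M_n) P by apply/esym/scalar_mxC.
have Xl : ('X%:M : 'M[{poly F}]_n) ^+ l = ('X^l)%:M.
  elim: (l) => [|j IHj]; first by rewrite !expr0.
  by rewrite !exprS IHj -mulmxE -scalar_mxM.
have := subrXX_comm l cXP; rewrite Pl subr0 Xl => /(congr1 determinant).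
rewrite -mulmxE det_mulmx det_scalar -exprM => hdet.
have : char_poly M %| 'X^(l * n) by rewrite hdet dvdp_mulIl.
move/(poly_monic_dvd_Xn (char_poly_monic _)) => ->.
by rewrite size_char_poly.
Qed.

Lemma mxtrace_nilpotent (F : fieldType) n (M : 'M[F]_n) l :
  M ^+ l = 0 -> \tr M = 0.
Proof.
case: n M => [|n] M /char_poly_nilpotent hM; first by rewrite /mxtrace big_ord0.
apply/eqP; rewrite -oppr_eq0 -char_poly_trace // hM coefXn /=.
by rewrite ltn_eqF.
Qed.

Lemma char_poly_split (C : closedFieldType) n (M : 'M[C]_n) :
  exists2 r : seq C, char_poly M = \prod_(z <- r) ('X - z%:P) & \tr M = \sum_(z <- r) z.
Proof.
have [r] := closed_field_poly_normal (char_poly M).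
rewrite (monicP (char_poly_monic M)) scale1r => hr; exists r => //.
have sr : size r = n.
  by apply: succn_inj; rewrite -(size_char_poly M) hr size_prod_XsubC.
case: (posnP n) => [n0|n0].
  have -> : r = [::] by apply/nilP; rewrite /nilp sr n0.
  by clear sr; subst n; rewrite big_nil /mxtrace big_ord0.
apply: oppr_inj; rewrite -char_poly_trace // hr -[in X in _`_X.-1]sr.
by rewrite coefPn_prod_XsubC // sr -lt0n.
Qed.

(** If all eigenvalues were 0, the characteristic polynomial would be a power of ['X] and
    Cayley-Hamilton would make [M] nilpotent. *)
Lemma nonnilpotent_eigenvalue (C : closedFieldType) n (M : 'M[C]_n) :
  (forall l, M ^+ l != 0) ->
  exists a (v : 'rV_n), [/\ a != 0, v != 0 & v *m M = a *: v].
Proof.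
case: n M => [|n] M hM; first by have := hM 0%N; rewrite [_ ^+ _]flatmx0 eqxx.
have [r hr _] := char_poly_split M.
have [/allP r0|/allPn [a ar a0]] := boolP (all (fun z => z == 0) r); last first.
  have : eigenvalue M a by rewrite eigenvalue_root_char hr root_prod_XsubC.
  by move=> /eigenvalueP[v hv v0]; exists a, v.
have {}hr : char_poly M = 'X^(size r).
  rewrite hr big_seq (eq_bigr (fun=> 'X)); last by move=> z /r0 /eqP ->; rewrite subr0.
  by rewrite -big_seq big_const_seq count_predT iter_mulr_1.
have := Cayley_Hamilton M; rewrite hr rmorphXn /= horner_mx_X => /eqP h.
by have := hM (size r); rewrite h.
Qed.

(** A maximal nonzero minor over [k] is the reduction of a minor that is invertible in [O], hence
    nonzero in [C]. *)
Lemma mxrank_reduction (O : comNzRingType) (C k : fieldType)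
    (i : {rmorphism O -> C}) (f : {rmorphism O -> k}) :
  (forall o, f o != 0 -> exists o', o' * o = 1) ->
  forall m n (A : 'M[O]_(m, n)), (\rank (map_mx f A) <= \rank (map_mx i A))%N.
Proof.
move=> hf m n A; set B := map_mx f A.
pose g1 := maxrankfun B; pose B1 := rowsub g1 B.
have B1f : row_full B1^T.
  by rewrite /row_full mxrank_tr; apply: maxrowsub_free.
pose g2 := fullrankfun B1f; pose A2 := mxsub g1 g2 A.
have : \det (map_mx f A2) != 0.
  rewrite -unitfE -unitmxE -unitmx_tr.
  by have := fullrowsub_unit B1f; congr (_ \in unitmx); apply/matrixP => x y; rewrite !mxE.
rewrite det_map_mx => /hf [o ho].
have iu : map_mx i A2 \in unitmx.
  rewrite unitmxE det_map_mx unitfE; apply/eqP => h0.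
  by have /eqP := congr1 i ho; rewrite rmorphM h0 mulr0 rmorph1 eq_sym oner_eq0.
rewrite -(mxrank_unit iu).
have -> : map_mx i A2 = rowsub g1 1%:M *m map_mx i A *m colsub g2 1%:M.
  rewrite -rowsubE mulmx_colsub mulmx1.
  by apply/matrixP => x y; rewrite !mxE.
by rewrite (leq_trans (mxrankM_maxl _ _)) // mxrankM_maxr.
Qed.

(** The two row spaces coincide. Applied to elements of minimal rank, this stands in for the
    invertibility of [x] in the corner of [e]. *)
Lemma mxrank_left_divisor (F : fieldType) n (e x : 'M[F]_n) :
  x *m e = x -> \rank x = \rank e -> exists z, e = z *m x.
Proof.
move=> hx hr; apply/submxP; have xe : (x <= e)%MS by rewrite -hx submxMl.
by rewrite -(geq_leqif (mxrank_leqif_sup xe)) hr.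
Qed.

(** The eigenvector lies in the row space of [h] and is killed by [h - a%:M]. If [h] has minimal
    rank, the product must therefore vanish, that is [h *m h = a *: h]. *)
Lemma mxrank_mulB_eigen (F : fieldType) n (h : 'M[F]_n) a (v : 'rV_n) :
  v != 0 -> v *m h = a *: v -> (v <= h)%MS -> (\rank (h *m (h - a%:M)) < \rank h)%N.
Proof.
move=> v0 hv vh; rewrite -(mxrank_mul_ker h (h - a%:M)) -addn1 leq_add2l.
rewrite lt0n mxrank_eq0; apply: contra v0 => /eqP h0; rewrite -submx0 -h0.
by rewrite sub_capmx vh; apply/sub_kermxP; rewrite mulmxBr hv mul_mx_scalar subrr.
Qed.

(** * Finite algebras that split over an extension *)

Section FiniteMatrixDomain.
Variables (F : finFieldType) (n : nat) (D : {set 'M[F]_n}) (e : 'M[F]_n).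

Record matrix_domain : Prop := MatrixDomain {
  domain_unit : e \in D;
  domain_neq0 : e != 0;
  domainB : forall x y, x \in D -> y \in D -> x - y \in D;
  domainM : forall x y, x \in D -> y \in D -> x *m y \in D;
  domain_mul1 : forall x, x \in D -> e *m x = x;
  domain_1mul : forall x, x \in D -> x *m e = x;
  domain_integral : forall x y, x \in D -> y \in D -> x *m y = 0 -> x = 0 \/ y = 0 }.
Hypothesis hD : matrix_domain.

Definition domain_pred of matrix_domain : {pred 'M[F]_n} := fun x => x \in D.

Lemma domain_pred_zmod : zmod_closed (domain_pred hD).
Proof.
have De := domain_unit hD; split; last exact: (domainB hD).
by rewrite -(subrr e); apply: (domainB hD).
Qed.
HB.instance Definition _ :=
  GRing.isZmodClosed.Build _ (domain_pred hD) domain_pred_zmod.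

Record domain_type := DomainType { dval : 'M[F]_n; _ : dval \in domain_pred hD }.
HB.instance Definition _ := [isSub for dval].
HB.instance Definition _ := [Finite of domain_type by <:].
HB.instance Definition _ := [SubChoice_isSubZmodule of domain_type by <:].

Lemma domain_mul_subproof (x y : domain_type) : val x *m val y \in domain_pred hD.
Proof. exact: (domainM hD (valP x) (valP y)). Qed.
Definition domain_mul x y : domain_type := DomainType (domain_mul_subproof x y).
Definition domain_one : domain_type := @DomainType e (domain_unit hD).

Lemma domain_mulA : associative domain_mul.
Proof. by move=> x y z; apply: val_inj; rewrite /= mulmxA. Qed.
Lemma domain_mul1l : left_id domain_one domain_mul.
Proof. by move=> x; apply/val_inj/(domain_mul1 hD)/valP. Qed.
Lemma domain_mul1r : right_id domain_one domain_mul.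
Proof. by move=> x; apply/val_inj/(domain_1mul hD)/valP. Qed.
Lemma domain_mulDl : left_distributive domain_mul +%R.
Proof. by move=> x y z; apply: val_inj; rewrite /= mulmxDl. Qed.
Lemma domain_mulDr : right_distributive domain_mul +%R.
Proof. by move=> x y z; apply: val_inj; rewrite /= mulmxDr. Qed.
Lemma domain_1neq0 : domain_one != 0.
Proof. by rewrite -val_eqE /= (domain_neq0 hD). Qed.

HB.instance Definition _ := GRing.Zmodule_isNzRing.Build domain_type
  domain_mulA domain_mul1l domain_mul1r domain_mulDl domain_mulDr domain_1neq0.

Definition domain_isunit : pred domain_type :=
  fun x => `[< exists y : domain_type, y * x = 1 /\ x * y = 1 >].
Definition domain_inv (x : domain_type) : domain_type :=
  if domain_isunit x then xget 0 [set y | y * x = 1 /\ x * y = 1]%classic else x.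

Lemma domain_inv_spec x : domain_isunit x ->
  domain_inv x * x = 1 /\ x * domain_inv x = 1.
Proof.
move=> hx; rewrite /domain_inv hx; move/asboolP: hx.
exact: (@xgetPex _ 0 [set y | y * x = 1 /\ x * y = 1]%classic).
Qed.
Lemma domain_mulVx : {in domain_isunit, left_inverse 1 domain_inv *%R}.
Proof. by move=> x /domain_inv_spec[]. Qed.
Lemma domain_mulxV : {in domain_isunit, right_inverse 1 domain_inv *%R}.
Proof. by move=> x /domain_inv_spec[]. Qed.
Lemma domain_unitP x y : y * x = 1 /\ x * y = 1 -> domain_isunit x.
Proof. by move=> h; apply/asboolP; exists y. Qed.
Lemma domain_inv_out : {in [predC domain_isunit], domain_inv =1 id}.
Proof. by move=> x /negP hx; rewrite /domain_inv; case: ifP. Qed.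

HB.instance Definition _ := GRing.NzRing_hasMulInverse.Build domain_type
  domain_mulVx domain_mulxV domain_unitP domain_inv_out.

(* Wedderburn's little theorem, for a domain whose identity [e] need not be
   the identity matrix. *)
Lemma finite_matrix_domain_comm x y : x \in D -> y \in D -> x *m y = y *m x.
Proof.
move=> Dx Dy; have hdom : GRing.integral_domain_axiom domain_type.
  move=> a b /(congr1 val) /= h.
  by case: (domain_integral hD (valP a) (valP b) h) => h0; apply/orP; [left|right];
    rewrite -val_eqE /= h0.
exact: (congr1 val (finDomain_mulrC hdom (@DomainType x Dx) (@DomainType y Dy))).
Qed.
End FiniteMatrixDomain.

Lemma finite_idempotent_power (F : finFieldType) n (c : 'M[F]_n) :
  exists2 l, (0 < l)%N & c ^+ l *m c ^+ l = c ^+ l.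
Proof.
have [i [j [lt_ij hij]]] : exists i j, (i < j)%N /\ c ^+ i = c ^+ j.
  pose g (i : 'I_(#|{: 'M[F]_n}|).+1) := c ^+ i.
  have : ~~ injectiveb g.
    by apply/negP => /injectiveP/leq_card; rewrite card_ord ltnn.
  case/injectivePn => x [y xy gxy].
  have := xy; rewrite -val_eqE neq_ltn => /orP[h|h]; first by exists x, y.
  by exists y, x.
have step m : (i <= m)%N -> c ^+ (m + (j - i)) = c ^+ m.
  by move=> im; rewrite -{1}(subnK im) -addnA subnKC ?(ltnW lt_ij) // exprD -hij -exprD subnK.
have steps t m : (i <= m)%N -> c ^+ (m + t * (j - i)) = c ^+ m.
  move=> im; elim: t => [|t IHt]; first by rewrite addn0.
  by rewrite mulSn addnCA addnC step ?IHt // (leq_trans im) ?leq_addr.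
(* A positive multiple of the period [j - i] that is at least [i], where periodicity begins. *)
exists (i.+1 * (j - i))%N; first by rewrite muln_gt0 subn_gt0.
rewrite mulmxE -exprD steps //.
by rewrite (leq_trans (leqnSn i)) // leq_pmulr // subn_gt0.
Qed.

(** On elementary matrices [X] and [Y], commutation becomes an identity between products of three
    entries of [P]. Summed against [P *m P = P], it factors [P] through one of its columns and one
    of its rows. *)
Lemma matrix_unit_comm_rank1 (k : fieldType) n (P : 'M[k]_n) :
  P != 0 -> P *m P = P ->
  (forall X Y, P *m X *m P *m Y *m P = P *m Y *m P *m X *m P) ->
  exists (u : 'cV_n) (w : 'rV_n) i j, P = u *m w /\ P i j != 0.
Proof.
move=> P0 PP hcomm.
have [b [c Pbc]] := matrix0Pn P P0.
have entry X i j x y : (P *m (delta_mx i j *m X)) x y = P x i * X j y.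
  by rewrite -(mul_delta_mx (0 : 'I_1)) -mulmxA -rowE mulmxA -colE !mxE big_ord1 !mxE.
have key a d x y : P x a * P b c * P d y = P x c * P d a * P b y.
  have := congr1 (fun M : 'M_n => M x y) (hcomm (delta_mx a b) (delta_mx c d)).
  by rewrite -!mulmxA !entry !mulrA.
exists (col c P), (\sum_a P a a / P b c *: row b P), b, c; split=> //.
apply/matrixP => x y; rewrite -[in LHS]PP !mxE big_ord1 !mxE summxE mulr_sumr;
  apply: eq_bigr => a _.
rewrite !mxE; apply: (mulfI Pbc); rewrite mulrCA mulrA key; field.
exact: Pbc.
Qed.

Section SplitFiniteAlgebra.
Variables (F : finFieldType) (k : fieldType) (h : {rmorphism F -> k}).
Variables (N n : nat) (B : {set 'M[F]_N}) (E : 'I_n -> 'I_n -> 'M[k]_N) (i0 : 'I_n).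
Hypotheses (BB : forall x y, x \in B -> y \in B -> x - y \in B)
           (BM : forall x y, x \in B -> y \in B -> x *m y \in B).
Hypotheses (EE : forall i j i' j', E i j *m E i' j' = (j == i')%:R *: E i j')
           (E0 : E i0 i0 != 0).
Hypothesis EB : forall i j, exists c : 'M[F]_N -> k,
  E i j = \sum_(b in B) c b *: map_mx h b.
Hypothesis BE : forall b, b \in B -> exists M : 'M[k]_n,
  map_mx h b = \sum_i \sum_j M i j *: E i j.

(** The hypotheses [EB] and [BE] say that [B] and the units [E] have the same span over [k];
    [unit_comb] identifies that span with the full matrix algebra ['M[k]_n]. *)
Definition unit_comb (M : 'M[k]_n) : 'M[k]_N := \sum_i \sum_j M i j *: E i j.

Lemma unit_combM M M' : unit_comb M *m unit_comb M' = unit_comb (M *m M').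
Proof.
rewrite /unit_comb mulmx_suml; apply: eq_bigr => i _.
under [RHS]eq_bigr do rewrite mxE scaler_suml.
rewrite [RHS]exchange_big mulmx_suml; apply: eq_bigr => j _ /=.
rewrite mulmx_sumr (bigD1 j) //= [X in _ + X]big1 ?addr0; last first.
  move=> l /negPf jl; rewrite mulmx_sumr big1 // => m _.
  by rewrite -scalemxAl -scalemxAr EE (eq_sym j) jl scale0r !scaler0.
rewrite mulmx_sumr; apply: eq_bigr => l _.
by rewrite -scalemxAl -scalemxAr EE eqxx scale1r scalerA.
Qed.

Lemma unit_combB M M' : unit_comb (M - M') = unit_comb M - unit_comb M'.
Proof.
rewrite /unit_comb -sumrB; apply: eq_bigr => i _; rewrite -sumrB.
by apply: eq_bigr => j _; rewrite !mxE scalerBl.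
Qed.

Lemma unit_comb_delta i j : unit_comb (delta_mx i j) = E i j.
Proof.
rewrite /unit_comb (bigD1 i) //= (bigD1 j) //= mxE !eqxx scale1r.
rewrite !big1 ?addr0 // => [l /negPf li|l /negPf lj].
  by apply: big1 => m _; rewrite mxE li scale0r.
by rewrite mxE lj andbF scale0r.
Qed.

Lemma unit_comb_coef M i j : E i0 i *m unit_comb M *m E j i0 = M i j *: E i0 i0.
Proof.
rewrite -!unit_comb_delta !unit_combM.
have -> : delta_mx i0 i *m M *m delta_mx j i0 = M i j *: delta_mx i0 i0 :> 'M_n.
  rewrite -(mul_delta_mx (0 : 'I_1) i0 i) -(mulmxA _ _ M) -rowE -(mul_delta_mx (0 : 'I_1) j i0).
  rewrite -mulmxA (mulmxA (row i M)) -colE -(mul_delta_mx (0 : 'I_1) i0 i0) scalemxAr.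
  by congr (_ *m _); apply/matrixP => x y; rewrite !mxE big_ord1 !mxE [x]ord1 eqxx.
rewrite /unit_comb scaler_sumr; apply: eq_bigr => a _; rewrite scaler_sumr.
by apply: eq_bigr => b _; rewrite mxE scalerA.
Qed.

Lemma unit_comb_inj : injective unit_comb.
Proof.
move=> M M' hM; apply/matrixP => i j; have := unit_comb_coef M i j.
rewrite hM unit_comb_coef => /eqP; rewrite -subr_eq0 -scalerBl scaler_eq0 (negPf E0) orbF.
by rewrite subr_eq0 => /eqP.
Qed.

(* A nonzero element of minimal rank of [B] can be chosen non-nilpotent; it has
   an idempotent power [e], and [e B e] is a finite division ring, hence a field, so that
   the coordinate matrix of [e] has rank one. *)
Lemma finite_algebra_primitive_idempotent :
  exists2 e, e \in B & \rank e = \rank (E i0 i0).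
Proof.
have /choice [co hco] : forall b, exists M, b \in B -> map_mx h b = unit_comb M.
  by move=> b; have [/BE[M hM]|] := boolP (b \in B); [exists M | exists 0].
have coE i j : exists c : 'M[F]_N -> k, delta_mx i j = \sum_(b in B) c b *: co b.
  have [c hc] := EB i j; exists c; apply: unit_comb_inj; rewrite unit_comb_delta hc.
  transitivity (\sum_(b in B) c b *: unit_comb (co b)).
    by apply: eq_bigr => b /hco ->.
  rewrite /unit_comb; under eq_bigr do rewrite scaler_sumr.
  rewrite exchange_big; apply: eq_bigr => i' _ /=.
  under eq_bigr do rewrite scaler_sumr.
  rewrite exchange_big; apply: eq_bigr => j' _ /=.
  by rewrite summxE scaler_suml; apply: eq_bigr => b _; rewrite mxE scalerA.
(* The coordinate matrices of [B] span ['M[k]_n], so a property stable under linear combinations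
   need only be checked on them. *)
have ext (Q : 'M[k]_n -> Prop) : (forall s X Y, Q X -> Q Y -> Q (s *: X + Y)) ->
    (forall b, b \in B -> Q (co b)) -> Q 0 -> forall X, Q X.
  move=> Qlin QB Q0; have Qsum (I : finType) (P : pred I) (G : I -> 'M[k]_n) (x : I -> k) :
      (forall t, P t -> Q (G t)) -> Q (\sum_(t | P t) x t *: G t).
    by move=> hG; elim/big_rec: _ => // t Y Pt QY; apply: Qlin => //; apply: hG.
  move=> X; rewrite (matrix_sum_delta X); under eq_bigr do rewrite -[\sum_j _]scale1r.
  apply: (Qsum) => i _; apply: (Qsum) => j _; have [c ->] := coE i j.
  exact: Qsum.
have coM a b : a \in B -> b \in B -> co (a *m b) = co a *m co b.
  move=> Ba Bb; apply: unit_comb_inj; rewrite -hco ?BM // map_mxM !hco //.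
  by rewrite unit_combM.
have co0 a : a \in B -> (co a == 0) = (a == 0).
  move=> Ba; have uc0 : unit_comb 0 = 0 by rewrite -(subrr (0 : 'M_n)) unit_combB subrr.
  by rewrite -(inj_eq unit_comb_inj) -hco // uc0 -(map_mx0 h) (inj_eq (@map_mx_inj _ _ h _ _)).
have [a1 /andP[Ba1 a1_0]] : exists a, (a \in B) && (a != 0).
  have [c hc] := EB i0 i0; apply: contrapT => hn; move/negP: E0; apply.
  rewrite hc big1 // => b Bb; have [->|b0] := eqVneq b 0; first by rewrite map_mx0 scaler0.
  by exfalso; apply: hn; exists b; rewrite Bb.
case: (@arg_minnP _ a1 (fun a => (a \in B) && (a != 0)) (fun a => \rank a)).
  by rewrite Ba1.
move=> a /andP[Ba a0] amin.
(* The trace form on ['M[k]_n] is nondegenerate and the [co b] span. A nonzero trace makes [a *m b]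
   non-nilpotent. *)
have [b Bb tr_ab] : exists2 b, b \in B & \tr (co a *m co b) != 0.
  apply: contrapT => hn; move: a0; rewrite -co0 // => /negP; apply; apply/eqP/matrixP => i j.
  have [c hc] := coE j i.
  have -> : co a i j = \tr (co a *m delta_mx j i).
    rewrite -(mul_delta_mx (0 : 'I_1)) mulmxA -colE mxtrace_mulC -rowE.
    by rewrite /mxtrace big_ord1 !mxE.
  rewrite hc mulmx_sumr linear_sum big1 ?mxE // => b Bb; rewrite -scalemxAr linearZ /=.
  apply/eqP; rewrite mulf_eq0; apply/orP; right; apply: contrapT => /negP h0.
  by apply: hn; exists b.
pose c := a *m b.
have Bc : c \in B by apply: BM.
have Bcl l : (0 < l)%N -> c ^+ l \in B /\ co (c ^+ l) = co c ^+ l.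
  case: l => // l _; elim: l => [|l [IHB IHc]]; first by rewrite !expr1.
  by rewrite exprS -mulmxE BM // coM // IHc mulmxE -exprS.
have cl0 l : (0 < l)%N -> c ^+ l != 0.
  move=> l0; have [Bl hl] := Bcl l l0; rewrite -co0 // hl; apply: contra tr_ab => /eqP h0.
  by rewrite -coM // (mxtrace_nilpotent h0).
have [l l0 el] := finite_idempotent_power c.
set e := c ^+ l in el; have [Be coe] := Bcl l l0; rewrite -/e in Be coe.
have e0 : e != 0 by apply: cl0.
have re : \rank e = \rank a.
  apply/eqP; rewrite eqn_leq amin ?Be // andbT /e; case: (l) l0 => // l' _.
  by rewrite exprS -mulmxE (leq_trans (mxrankM_maxl _ _)) // mxrankM_maxl.
pose D := [set x in B | (e *m x == x) && (x *m e == x)].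
have hD : matrix_domain D e.
  have DP x : reflect [/\ x \in B, e *m x = x & x *m e = x] (x \in D).
    rewrite inE; apply: (iffP and3P) => [[? /eqP ? /eqP ?]|[? ? ?]]; split=> //; exact/eqP.
  split=> //; first by apply/DP.
  - move=> x y /DP[Bx ex xe] /DP[By ey ye]; apply/DP; split; first exact: BB.
      by rewrite mulmxBr ex ey.
    by rewrite mulmxBl xe ye.
  - move=> x y /DP[Bx ex xe] /DP[By ey ye]; apply/DP; split; first exact: BM.
      by rewrite mulmxA ex.
    by rewrite -mulmxA ye.
  - by move=> x /DP[].
  - by move=> x /DP[].
  - move=> x y /DP[Bx ex xe] /DP[By ey ye] xy0; have [->|x0] := eqVneq x 0; first by left.
    (* Minimality gives equal ranks. The [z] below need not lie in [B]: it serves only to cancel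
       [x]. *)
    have rx : \rank x = \rank e.
      apply/eqP; rewrite eqn_leq -{1}xe mxrankM_maxr re amin //.
      by rewrite Bx.
    have [z hz] := mxrank_left_divisor xe rx.
    by right; rewrite -ey hz -mulmxA xy0 mulmx0.
have De d : d \in B -> e *m d *m e \in D.
  by move=> Bd; rewrite inE !BM //= !mulmxA el eqxx -!mulmxA el eqxx.
have coee : co e *m co e = co e by rewrite -coM // el.
(* Commutativity of the finite corner [e B e] extends bilinearly to the whole corner of [co e] over
   [k]. *)
have comm X Y : co e *m X *m co e *m Y *m co e = co e *m Y *m co e *m X *m co e.
  have h1 d : d \in B -> forall X,
      co e *m X *m co e *m co d *m co e = co e *m co d *m co e *m X *m co e.
    move=> Bd; apply: ext => [s P Q hP hQ|b' Bb'|]; last by rewrite !(mulmx0, mul0mx).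
      by rewrite !(mulmxDr, mulmxDl) -!(scalemxAr, scalemxAl) hP hQ.
    have := finite_matrix_domain_comm hD (De _ Bb') (De _ Bd).
    rewrite -!mulmxA !(mulmxA e e) el => /(congr1 co).
    by rewrite !coM ?BM // !mulmxA.
  apply: (ext (fun Y => _ *m Y *m _ = co e *m Y *m _ *m _ *m _)) => [s P Q hP hQ|d Bd|].
  - by rewrite !(mulmxDr, mulmxDl) -!(scalemxAr, scalemxAl) hP hQ.
  - by rewrite h1.
  - by rewrite !(mulmx0, mul0mx).
have coe0 : co e != 0 by rewrite co0.
have [u [w [i [j [huw Pij]]]]] := matrix_unit_comm_rank1 coe0 coee comm.
exists e => //; rewrite -(mxrank_map h) hco //.
(* Each of [unit_comb (co e)] and [E i0 i0] is, up to a scalar, a product containing the other as a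
   factor. *)
apply/eqP; rewrite eqn_leq; apply/andP; split.
  have -> : unit_comb (co e) = (\sum_i u i 0 *: E i i0) *m E i0 i0 *m (\sum_j w 0 j *: E i0 j).
    rewrite huw /unit_comb !mulmx_suml; apply: eq_bigr => x _; rewrite mulmx_sumr.
    apply: eq_bigr => y _; rewrite mxE big_ord1 -!scalemxAl -scalemxAr !EE !eqxx.
    by rewrite !scale1r EE eqxx scale1r scalerA.
  by rewrite (leq_trans (mxrankM_maxl _ _)) // mxrankM_maxr.
have -> : E i0 i0 = (co e i j)^-1 *: (E i0 i *m unit_comb (co e) *m E j i0).
  by rewrite unit_comb_coef scalerA mulVf // scale1r.
rewrite (leq_trans (mxrank_scale _ _)) //.
by rewrite (leq_trans (mxrankM_maxl _ _)) // mxrankM_maxr.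
Qed.
End SplitFiniteAlgebra.

(** * Coherent matrices and their central idempotents *)

(** A scheme seen as a coloring of pairs of indices. Constancy on color classes then replaces
    membership in the adjacency algebra, and it makes sense over any ring, in particular over
    [O]. *)
Record coherent_coloring (N : nat) (K : finType) (c : 'I_N -> 'I_N -> K) (d : K) (tr : K ->
  K) : Prop :=
  CoherentColoring {
    coloring_diag : forall i j, (c i j == d) = (i == j);
    coloring_tr : forall i j, c j i = tr (c i j);
    coloring_regular : forall r s i j i' j', c i j = c i' j' ->
      #|[set l | (c i l == r) && (c l j == s)]| = #|[set l | (c i' l == r) && (c l j' == s)]| }.

Section Coherent.
Variables (N : nat) (K : finType) (c : 'I_N -> 'I_N -> K) (d : K) (tr : K -> K).
Hypothesis hc : coherent_coloring c d tr.

Definition coherent (R : Type) (A : 'M[R]_N) :=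
  forall i j i' j', c i j = c i' j' -> A i j = A i' j'.

Definition colormx (R : pzRingType) (s : K) : 'M[R]_N := \matrix_(i, j) (c i j == s)%:R.

(** [K] may have elements that are not colors of any pair; they receive the coefficient 0. *)
Definition colorcoef (R : pzRingType) (A : 'M[R]_N) (s : K) : R :=
  if [pick u : 'I_N * 'I_N | c u.1 u.2 == s] is Some u then A u.1 u.2 else 0.

Lemma colorcoefE (R : pzRingType) (A : 'M[R]_N) i j :
  coherent A -> colorcoef A (c i j) = A i j.
Proof.
move=> hA; rewrite /colorcoef; case: pickP => [u /eqP hu|/(_ (i, j))]; last by rewrite eqxx.
exact: hA.
Qed.

Lemma coherent_sum_colormx (R : pzRingType) (A : 'M[R]_N) :
  coherent A -> A = \sum_s colorcoef A s *: colormx R s.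
Proof.
move=> hA; apply/matrixP => i j; rewrite summxE (bigD1 (c i j)) //= !mxE eqxx mulr1.
rewrite colorcoefE // big1 ?addr0 // => s /negPf hs.
by rewrite !mxE eq_sym hs mulr0.
Qed.

Lemma coherent_colormx (R : pzRingType) s : coherent (colormx R s).
Proof. by move=> i j i' j' h; rewrite !mxE h. Qed.

Lemma coherentD (R : pzRingType) (A B : 'M[R]_N) :
  coherent A -> coherent B -> coherent (A + B).
Proof. by move=> hA hB i j i' j' h; rewrite !mxE (hA _ _ _ _ h) (hB _ _ _ _ h). Qed.

Lemma coherentB (R : pzRingType) (A B : 'M[R]_N) :
  coherent A -> coherent B -> coherent (A - B).
Proof. by move=> hA hB i j i' j' h; rewrite !mxE (hA _ _ _ _ h) (hB _ _ _ _ h). Qed.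

Lemma coherentZ (R : pzRingType) a (A : 'M[R]_N) : coherent A -> coherent (a *: A).
Proof. by move=> hA i j i' j' h; rewrite !mxE (hA _ _ _ _ h). Qed.

Lemma coherent0 (R : pzRingType) : coherent (0 : 'M[R]_N).
Proof. by move=> i j i' j' h; rewrite !mxE. Qed.

Lemma coherent_sum (R : pzRingType) (I : Type) (r : seq I) (P : pred I) (A : I -> 'M[R]_N) :
  (forall i, P i -> coherent (A i)) -> coherent (\sum_(i <- r | P i) A i).
Proof. by move=> h; apply: big_ind => //; [apply: coherent0 | apply: coherentD]. Qed.

Lemma coherent_map (R R' : Type) (f : R -> R') (A : 'M[R]_N) :
  coherent A -> coherent (map_mx f A).
Proof. by move=> hA i j i' j' h; rewrite !mxE (hA _ _ _ _ h). Qed.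

Lemma coherent1 (R : pzRingType) : coherent (1%:M : 'M[R]_N).
Proof. by move=> i j i' j' h; rewrite !mxE -!(coloring_diag hc) h. Qed.

Lemma coherentT (R : Type) (A : 'M[R]_N) : coherent A -> coherent A^T.
Proof. by move=> hA i j i' j' h; rewrite !mxE; apply: hA;
  rewrite !(coloring_tr hc _ j) !(coloring_tr hc _ j') h. Qed.

Lemma coloring_trK s i j : c i j = s -> tr (tr s) = s.
Proof. by move=> <-; rewrite -!(coloring_tr hc). Qed.

Lemma colormxT (R : pzRingType) i j : (colormx R (c i j))^T = colormx R (tr (c i j)).
Proof.
apply/matrixP => x y; rewrite !mxE (coloring_tr hc x y); congr ((nat_of_bool _)%:R).
apply/idP/idP => [/eqP <-|/eqP h]; first by rewrite -!(coloring_tr hc).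
by rewrite -(coloring_trK (erefl (c x y))) h -!(coloring_tr hc).
Qed.

(** Grouping the middle indices by their pair of colors leaves only intersection numbers, which
    depend on the color of [(i, j)] alone. *)
Lemma coherent_mul (R : pzRingType) (A B : 'M[R]_N) :
  coherent A -> coherent B -> coherent (A *m B).
Proof.
move=> hA hB.
have entry i j : (A *m B) i j = \sum_(rs : K * K) (colorcoef A rs.1 * colorcoef B rs.2) *+
    #|[set l | (c i l == rs.1) && (c l j == rs.2)]|.
  rewrite mxE (partition_big (fun l => (c i l, c l j)) xpredT) //=; apply: eq_bigr => -[r s] _ /=.
  rewrite -sumr_const; apply: eq_big => [l|l /eqP [<- <-]]; first by rewrite inE -pair_eqE.
  by rewrite !colorcoefE.
move=> i j i' j' h; rewrite !entry; apply: eq_bigr => -[r s] _.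
by rewrite (coloring_regular hc r s h).
Qed.

End Coherent.

Lemma mxtrace_idempotent (F : fieldType) n (P : 'M[F]_n) :
  P *m P = P -> \tr P = (\rank P)%:R.
Proof.
move=> PP; have UW := mulmx_base P; have rf := row_base_free P.
have cf : row_free (col_base P)^T by rewrite /row_free mxrank_tr; have := col_base_full P.
move: (col_base P) (row_base P) UW rf cf => U W UW rf cf.
have WU : W *m U = 1%:M.
  apply: (row_free_inj rf); rewrite mul1mx; apply: trmx_inj.
  apply: (row_free_inj cf); rewrite -!trmx_mul; congr trmx.
  by rewrite !mulmxA UW -mulmxA UW PP.
by rewrite -[in LHS]UW mxtrace_mulC WU mxtrace1.
Qed.

Section CentralIdempotents.
Variables (N : nat) (K : finType) (c : 'I_N -> 'I_N -> K) (d : K) (tr : K -> K).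
Hypothesis hc : coherent_coloring c d tr.
Variable (C : fieldType).
Implicit Types e f P Q : 'M[C]_N.

Definition coherent_central_idempotent e :=
  [/\ coherent c e, forall A, coherent c A -> e *m A = A *m e & e *m e = e].

Definition coherent_primitive P :=
  [/\ coherent_central_idempotent P, P != 0 &
     forall e f, coherent_central_idempotent e -> coherent_central_idempotent f ->
       e *m f = 0 -> P = e + f -> e = 0 \/ f = 0].
Local Notation cci := coherent_central_idempotent.

Lemma central_idempotentM e f : cci e -> cci f -> cci (e *m f).
Proof.
move=> [ce ze ee] [cf zf ff]; split=> [|A hA|]; first exact: (coherent_mul hc).
  by rewrite -mulmxA zf // !mulmxA ze.
by rewrite mulmxA -(mulmxA e) zf // mulmxA ee -mulmxA ff.
Qed.

Lemma central_idempotentB e f : cci e -> cci f -> e *m f = f -> cci (e - f).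
Proof.
move=> [ce ze ee] [cf zf ff] ef; split=> [|A hA|]; first exact: coherentB.
  by rewrite mulmxBl mulmxBr ze // zf.
by rewrite mulmxBr !mulmxBl ee ef ff -ze // ef subrr subr0.
Qed.

Lemma central_idempotent1 : cci 1%:M.
Proof. by split=> [|A _|]; rewrite ?mul1mx ?mulmx1 //; apply: (coherent1 hc). Qed.

Lemma primitive_dichotomy P e : coherent_primitive P -> cci e -> P *m e = 0 \/ P *m e = P.
Proof.
move=> [zP P0 Pmin] ze; have zPe := central_idempotentM zP ze.
have PPe : P *m (P *m e) = P *m e by rewrite mulmxA; case: zP => _ _ ->.
have := Pmin _ _ zPe (central_idempotentB zP zPe PPe).
case; first by rewrite mulmxBr; case: zPe => cPe _ ->; case: zP => _ <- //; rewrite PPe subrr.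
- by rewrite addrC subrK.
- by left.
- by move/eqP; rewrite subr_eq0 => /eqP <-; right.
Qed.

Lemma primitive_orthogonal P Q :
  coherent_primitive P -> coherent_primitive Q -> P != Q -> P *m Q = 0.
Proof.
move=> hP hQ nPQ; case: (hP) (hQ) => [zP _ _] [zQ _ _].
case: (primitive_dichotomy hP zQ) => // PQ.
case: (primitive_dichotomy hQ zP) => QP; have [cQ _ _] := zQ; have [_ cP _] := zP.
  by rewrite cP.
by case/eqP: nPQ; rewrite -PQ cP.
Qed.

(** A nonzero idempotent that is not primitive splits into two orthogonal ones of smaller rank.
    Their lists are disjoint, because a common [P] would satisfy [P = P *m f *m g = 0]. *)
Lemma central_idempotent_decomposition e : cci e ->
  exists L : seq 'M[C]_N, [/\ uniq L, forall P, P \in L ->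
    coherent_primitive P & e = \sum_(P <- L) P].
Proof.
have sumL L P : uniq L -> (forall P, P \in L -> coherent_primitive P) -> P \in L ->
    P *m (\sum_(Q <- L) Q) = P.
  move=> uL hL PL; rewrite mulmx_sumr (bigD1_seq P) //= big_seq_cond big1 ?addr0.
    by have [[_ _ ->]] := hL P PL.
  by move=> Q /andP[QL nQ]; apply: primitive_orthogonal; rewrite 1?eq_sym //; apply: hL.
move: {2}(\rank e).+1 (ltnSn (\rank e)) => r; elim: r e => // r IHr e re ze.
have [->|e0] := eqVneq e 0; first by exists [::]; split=> //; rewrite big_nil.
case: (pselect (coherent_primitive e)) => he.
  by exists [:: e]; split=> // [P|]; rewrite ?inE ?big_seq1 // => /eqP ->.
have [f [g [zf zg fg efg [f0 g0]]]] : exists f g,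
    [/\ cci f, cci g, f *m g = 0, e = f + g & f != 0 /\ g != 0].
  apply: contrapT => hn; apply: he; split=> // f g zf zg fg efg.
  have [->|f0] := eqVneq f 0; first by left.
  have [->|g0] := eqVneq g 0; first by right.
  by exfalso; apply: hn; exists f, g.
have gf : g *m f = 0 by case: zf => cf zf' _; case: zg => _ -> //.
have rk x y : cci x -> cci y -> x *m y = 0 -> y *m x = 0 -> e = x + y -> y != 0 ->
    (\rank x < r.+1)%N && (\rank x < \rank e)%N.
  move=> [cx zx xx] [cy zy yy] xy yx exy y0.
  have xe : x *m e = x by rewrite exy mulmxDr xx xy addr0.
  suff h : (\rank x < \rank e)%N by rewrite h andbT (leq_trans h) // ltnW.
  rewrite ltn_neqAle -{2}xe mxrankM_maxr andbT; apply: contra y0 => /eqP rx.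
  have [z hz] := mxrank_left_divisor xe rx.
  by rewrite -[y]yy -[y in y *m _](addKr x) -exy mulmxDl mulNmx xy oppr0 add0r hz -mulmxA xy mulmx0.
have /andP[_ rf] := rk f g zf zg fg gf efg g0.
have /andP[_ rg] := rk g f zg zf gf fg (etrans efg (addrC _ _)) f0.
have [Lf [uf hf sf]] := IHr f (leq_trans rf re) zf.
have [Lg [ug hg sg]] := IHr g (leq_trans rg re) zg.
exists (Lf ++ Lg); split; last by rewrite big_cat /= -sf -sg.
- rewrite cat_uniq uf ug andbT; apply/hasPn => P Pg; apply/negP => /= Pf.
  have [_ /eqP] := hf P Pf; case.
  by rewrite -(sumL _ _ ug hg Pg) -(sumL _ _ uf hf Pf) -sf -sg -mulmxA fg mulmx0.
- by move=> P; rewrite mem_cat => /orP[/hf|/hg].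
Qed.

Lemma primitive_list : exists L : seq 'M[C]_N,
  [/\ uniq L, forall P, P \in L <-> coherent_primitive P & \sum_(P <- L) P = 1%:M].
Proof.
have [L [uL hL sL]] := central_idempotent_decomposition central_idempotent1.
exists L; split=> // P; split; first exact: hL.
move=> hP; apply: contrapT => /negP nPL; have [_ /eqP] := hP; case.
rewrite -[P]mulmx1 sL mulmx_sumr big_seq big1 // => Q QL.
apply: primitive_orthogonal => //; first exact: hL.
by apply: contra nPL => /eqP ->.
Qed.

End CentralIdempotents.

(** * Matrix units adapted to a valuation ring *)

Section ConjugateTranspose.
Variables (C : numClosedFieldType) (n : nat).
Implicit Types A B : 'M[C]_n.

Definition adjointmx A : 'M[C]_n := map_mx Num.conj A^T.

Lemma adjointmxM A B : adjointmx (A *m B) = adjointmx B *m adjointmx A.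
Proof. by rewrite /adjointmx trmx_mul map_mxM. Qed.

Lemma adjointmxK A : adjointmx (adjointmx A) = A.
Proof. by apply/matrixP => i j; rewrite !mxE conjCK. Qed.

Lemma adjointmxZ a A : adjointmx (a *: A) = a^* *: adjointmx A.
Proof. by apply/matrixP => i j; rewrite !mxE rmorphM. Qed.

Lemma adjointmx0 : adjointmx 0 = 0.
Proof. by apply/matrixP => i j; rewrite !mxE rmorph0. Qed.

Lemma adjointmx_sum (I : Type) (r : seq I) (P : pred I) (F : I -> 'M[C]_n) :
  adjointmx (\sum_(i <- r | P i) F i) = \sum_(i <- r | P i) adjointmx (F i).
Proof.
apply: (big_morph adjointmx _ adjointmx0) => A B.
by apply/matrixP => i j; rewrite !mxE rmorphD.
Qed.

Lemma adjointmx_tr_eq0 A : \tr (A *m adjointmx A) = 0 -> A = 0.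
Proof.
have h i : (A *m adjointmx A) i i = \sum_j A i j * (A i j)^*.
  by rewrite mxE; apply: eq_bigr => j _; rewrite !mxE.
move=> h0; apply/matrixP => i j; rewrite mxE; apply/eqP; rewrite -mul_conjC_eq0.
have hi0 : forall i, true -> (A *m adjointmx A) i i = 0.
  by apply: psumr_eq0P => // x _; rewrite h sumr_ge0 // => y _; apply: mul_conjC_ge0.
apply/eqP; move: j isT; apply: psumr_eq0P => [y _|]; first exact: mul_conjC_ge0.
by rewrite -h hi0.
Qed.

Lemma adjointmx_mul_eq0 A : adjointmx A *m A = 0 -> A = 0.
Proof.
move=> h; rewrite -[A]adjointmxK (@adjointmx_tr_eq0 (adjointmx A)) ?adjointmx0 //.
by rewrite adjointmxK h linear0.
Qed.
End ConjugateTranspose.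

Section MatrixUnits.
Variables (N : nat) (K : finType) (c : 'I_N -> 'I_N -> K) (d : K) (tr : K -> K).
Hypothesis hc : coherent_coloring c d tr.
Variables (C : numClosedFieldType) (V : set C).
Hypothesis hV : valuation_ring V.
Local Notation coh := (coherent c).
Local Notation prim := (@coherent_primitive N K c C).
Local Notation A_ := (colormx c C).

Lemma coherent_adjoint (A : 'M[C]_N) : coh A -> coh (adjointmx A).
Proof. by move=> hA; apply/coherent_map/(coherentT hc). Qed.

(** [e] generates a minimal left ideal with basis [u], and [v] is the dual basis of the right ideal
    of [e], so that the [u i *m v j] are matrix units of the block of [P]. By [mu_integral], the
    representation on that left ideal has its coefficients in [V]. *)
Record matrix_units n (P e : 'M[C]_N) (u v : 'I_n -> 'M[C]_N) : Prop := MatrixUnits {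
  mu_e : coh e;
  mu_e0 : e != 0;
  mu_ee : e *m e = e;
  mu_u : forall i, coh (u i);
  mu_v : forall i, coh (v i);
  mu_ue : forall i, u i *m e = u i;
  mu_ev : forall i, e *m v i = v i;
  mu_vu : forall i j, v i *m u j = (i == j)%:R *: e;
  mu_sum : \sum_i u i *m v i = P;
  mu_corner : forall b, coh b -> exists t, e *m b *m e = t *: e;
  mu_integral : forall s i j, exists2 x, V x & v i *m A_ s *m u j = x *: e }.

Section MinimalRank.
Variable P : 'M[C]_N.
Hypothesis hP : prim P.

Let zP : coherent_central_idempotent c P. Proof. by case: hP. Qed.

Variables (a : 'M[C]_N).
Hypotheses (ca : coh a) (Pa : P *m a = a) (a0 : a != 0).
Hypothesis amin : forall b, coh b -> P *m b = b -> b != 0 -> (\rank a <= \rank b)%N.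

(** [h = a *m adjointmx a] has nonzero trace, hence a nonzero eigenvalue [x], and minimality of the
    rank gives [h *m h = x *: h]. As [h] is hermitian, [x] is real and [h / x] is a hermitian
    idempotent. *)
Lemma minimal_rank_projection : exists e,
  [/\ coh e, P *m e = e, e != 0, e *m e = e & adjointmx e = e /\ \rank e = \rank a].
Proof.
pose h := a *m adjointmx a.
have ch : coh h by apply: (coherent_mul hc) => //; apply: coherent_adjoint.
have Ph : P *m h = h by rewrite mulmxA Pa.
have adjh : adjointmx h = h by rewrite adjointmxM adjointmxK.
have trh : \tr h != 0 by apply: contra a0 => /eqP /adjointmx_tr_eq0 ->.
have h0 : h != 0 by apply: contra trh => /eqP ->; rewrite linear0.
have rh : \rank h = \rank a by apply/eqP; rewrite eqn_leq amin // mxrankM_maxl.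
have [x [v [x0 v0 hv]]] : exists x (v : 'rV_N), [/\ x != 0, v != 0 & v *m h = x *: v].
  apply: nonnilpotent_eigenvalue => l; apply: contra trh => /eqP hl.
  by rewrite (mxtrace_nilpotent hl).
have hh : h *m h = x *: h.
  apply/eqP; rewrite -subr_eq0 -mul_mx_scalar -mulmxBr; apply: contraT => hn.
  have vh : (v <= h)%MS by rewrite -[v]scale1r -(mulVf x0) -scalerA -hv scalemx_sub // submxMl.
  have := mxrank_mulB_eigen v0 hv vh; rewrite rh ltnNge amin //.
    apply: (coherent_mul hc) => //; apply: coherentB => //.
    by rewrite -scalemx1; apply/coherentZ/(coherent1 hc).
  by rewrite mulmxA Ph.
have xr : x^* = x.
  have := congr1 (@adjointmx C N) hh; rewrite adjointmxM adjh hh adjointmxZ adjh.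
  by move/eqP; rewrite -subr_eq0 -scalerBl scaler_eq0 (negPf h0) orbF subr_eq0 => /eqP.
exists (x^-1 *: h); split.
- exact: coherentZ.
- by rewrite -scalemxAr Ph.
- by rewrite scaler_eq0 invr_eq0 (negPf x0).
- by rewrite -scalemxAl -scalemxAr hh !scalerA divfK.
- by rewrite adjointmxZ adjh fmorphV /= xr mxrank_scale_nz ?invr_eq0.
Qed.

(** A nonzero [D = e b e] is not nilpotent, so minimality gives [D *m D = x *: D] for an eigenvalue
    [x]; writing [e = z *m D] then yields [D = x *: e]. *)
Lemma minimal_rank_corner e b : coh e -> P *m e = e -> e *m e = e -> \rank e = \rank a ->
  coh b -> exists t, e *m b *m e = t *: e.
Proof.
move=> ce Pe ee re cb; set D := e *m b *m e.
have cD : coh D by do 2!apply: (coherent_mul hc) => //.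
have eD : e *m D = D by rewrite /D !mulmxA ee.
have De : D *m e = D by rewrite /D -mulmxA ee.
have PD : P *m D = D by rewrite -eD mulmxA Pe.
have [->|D0] := eqVneq D 0; first by exists 0; rewrite scale0r.
have rD x : coh x -> P *m x = x -> x *m e = x -> x != 0 -> exists z, e = z *m x.
  move=> cx Px xe x0; apply: mxrank_left_divisor => //.
  by apply/eqP; rewrite eqn_leq re amin // -re -xe mxrankM_maxr.
have Dl l : D ^+ l.+1 != 0 /\ [/\ coh (D ^+ l.+1), P *m D ^+ l.+1 = D ^+ l.+1 & D ^+ l.+1 *m
  e = D ^+ l.+1].
  elim: l => [|l [IH0 [IHc IHP IHe]]]; first by rewrite expr1.
  rewrite exprSr -mulmxE -(mulmxA _ D) De (mulmxA P) IHP; split; last by split=> //;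
    apply: (coherent_mul hc).
  apply/eqP => h; have [z hz] := rD _ IHc IHP IHe IH0; case/eqP: D0.
  by rewrite -eD hz -mulmxA h mulmx0.
have [x [v [x0 v0 hv]]] : exists x (v : 'rV_N), [/\ x != 0, v != 0 & v *m D = x *: v].
  apply: nonnilpotent_eigenvalue => -[|l]; last by case: (Dl l).
  rewrite expr0; apply: contra D0 => /eqP h.
  by rewrite -[D]mul1mx -[1%:M]/1 h mul0mx.
have DD : D *m D = x *: D.
  apply/eqP; rewrite -subr_eq0 -mul_mx_scalar -mulmxBr; apply: contraT => hn.
  have vD : (v <= D)%MS by rewrite -[v]scale1r -(mulVf x0) -scalerA -hv scalemx_sub // submxMl.
  have := mxrank_mulB_eigen v0 hv vD.
  have rkD : \rank D = \rank a by apply/eqP; rewrite eqn_leq amin // andbT -re -De mxrankM_maxr.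
  rewrite rkD ltnNge amin //.
    apply: (coherent_mul hc) => //; apply: coherentB => //.
    by rewrite -scalemx1; apply/coherentZ/(coherent1 hc).
  by rewrite mulmxA PD.
have [z hz] := rD D cD PD De D0.
by exists x; rewrite -[D]eD {1}hz -mulmxA DD -scalemxAr -hz.
Qed.

Variable e : 'M[C]_N.
Hypotheses (ce : coh e) (Pe : P *m e = e) (e0 : e != 0) (ee : e *m e = e)
  (adje : adjointmx e = e) (corner : forall b, coh b -> exists t, e *m b *m e = t *: e).

(** The lattice spanned over [V] by the [A_ s *m e] is stable under every [A_ r], intersection
    numbers being integers. A basis [u] of this lattice gives integral coefficients; the dual [v]
    comes from the hermitian form with values in the multiples of [e]. *)
Lemma matrix_units_of_projection : exists n (u v : 'I_n -> 'M[C]_N), matrix_units P e u v.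
Proof.
have [T [spanT freeT]] := valuation_subbasis hV (fun s => A_ s *m e).
pose n := #|T|; pose u (j : 'I_n) := A_ (enum_val j) *m e.
have cA s : coh (A_ s) by apply: coherent_colormx.
have cu j : coh (u j) by apply: (coherent_mul hc).
have ue j : u j *m e = u j by rewrite -mulmxA ee.
have sumT (x : K -> C) : \sum_(t in T) x t *: (A_ t *m e) = \sum_(j < n) x (enum_val j) *: u j.
  by rewrite big_enum_val.
have ufree (x : 'I_n -> C) : \sum_j x j *: u j = 0 -> forall j, x j = 0.
  move=> hx j; have Tj : enum_val j \in T := enum_valP j.
  pose y t := x (enum_rank_in Tj t).
  have : \sum_(t in T) y t *: (A_ t *m e) = 0.
    by rewrite sumT -[RHS]hx; apply: eq_bigr => i _; rewrite /y enum_valK_in.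
  by move/freeT/(_ _ Tj); rewrite /y enum_valK_in.
have uspan b : coh b -> exists x : 'I_n -> C, b *m e = \sum_j x j *: u j.
  move=> cb; have /choice [y hy] : forall s, exists y : 'I_n -> C, A_ s *m e = \sum_j y j *: u j.
    by move=> s; have [y _ ->] := spanT s; rewrite sumT; exists (fun j => y (enum_val j)).
  exists (fun j => \sum_s colorcoef c b s * y s j).
  rewrite {1}(coherent_sum_colormx cb) mulmx_suml.
  under [RHS]eq_bigr do rewrite scaler_suml.
  rewrite exchange_big; apply: eq_bigr => s _ /=.
  by rewrite -scalemxAl hy scaler_sumr; apply: eq_bigr => j _; rewrite scalerA.
have eu j : e *m adjointmx (u j) = adjointmx (u j) by rewrite -{1}adje -adjointmxM ue.
have /choice [H' hH'] : forall ij : 'I_n * 'I_n, exists t, adjointmx (u ij.1) *m u ij.2 = t *: e.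
  move=> [i j] /=; have cb : coh (adjointmx (u i) *m u j).
    by apply: (coherent_mul hc) => //; apply: coherent_adjoint.
  by have [t ht] := corner cb; exists t; rewrite -ht mulmxA eu -mulmxA ue.
pose H := \matrix_(i, j) H' (i, j).
have hH i j : adjointmx (u i) *m u j = H i j *: e by rewrite mxE (hH' (i, j)).
(* A kernel vector [x] yields [y = \sum_j x_j u_j] killed by every [adjointmx (u i)], hence
   [adjointmx y *m y = 0] and [y = 0] by positivity. *)
have Hu : H \in unitmx.
  rewrite -unitmx_tr -row_free_unit -kermx_eq0; apply/eqP/row_matrixP => k.
  rewrite row0; set x := row k _.
  have hx : x *m H^T = 0 by apply/sub_kermxP; rewrite row_sub.
  pose y := \sum_j x 0 j *: u j.
  have y0 : y = 0.
    apply: adjointmx_mul_eq0; rewrite {1}/y adjointmx_sum mulmx_suml big1 // => i _.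
    rewrite adjointmxZ -scalemxAl /y mulmx_sumr.
    under eq_bigr do rewrite -scalemxAr hH scalerA.
    rewrite -scaler_suml; have := congr1 (fun M : 'rV_n => M 0 i) hx; rewrite !mxE.
    by under eq_bigr do rewrite !mxE; under [X in X *: e]eq_bigr do rewrite !mxE; move=> ->;
      rewrite scale0r scaler0.
  by apply/rowP => j; rewrite (ufree _ y0) mxE.
pose v i := \sum_j invmx H i j *: adjointmx (u j).
have cv i : coh (v i) by apply: coherent_sum => j _; apply/coherentZ/coherent_adjoint.
have ev i : e *m v i = v i.
  by rewrite mulmx_sumr; apply: eq_bigr => j _; rewrite -scalemxAr eu.
have vu i j : v i *m u j = (i == j)%:R *: e.
  rewrite mulmx_suml; under eq_bigr do rewrite -scalemxAl hH scalerA.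
  rewrite -scaler_suml; congr (_ *: _).
  by have := congr1 (fun M : 'M_n => M i j) (mulVmx Hu); rewrite !mxE.
have uadj i : adjointmx (u i) = \sum_j H i j *: v j.
  under eq_bigr do rewrite scaler_sumr.
  rewrite exchange_big /= (bigD1 i) //= [X in _ + X]big1 => [|j /negPf ji].
    rewrite addr0; under eq_bigr do rewrite scalerA.
    rewrite -scaler_suml; have := congr1 (fun M : 'M_n => M i i) (mulmxV Hu).
    by rewrite !mxE eqxx => ->; rewrite scale1r.
  under eq_bigr do rewrite scalerA.
  rewrite -scaler_suml; have := congr1 (fun M : 'M_n => M i j) (mulmxV Hu).
  by rewrite !mxE eq_sym ji => ->; rewrite scale0r.
(* [Q] acts as the identity on the left ideal and on the right ideal of [e]. Hence
   [b Q = Q b Q = Q b]: [Q] is a nonzero central idempotent below [P], and primitivity forces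
   [Q = P]. *)
pose Q := \sum_i u i *m v i.
have Qu j : Q *m u j = u j.
  rewrite mulmx_suml (bigD1 j) //= big1 => [|i /negPf ij].
    by rewrite addr0 -mulmxA vu eqxx scale1r ue.
  by rewrite -mulmxA vu ij scale0r mulmx0.
have vQ j : v j *m Q = v j.
  rewrite mulmx_sumr (bigD1 j) //= big1 => [|i /negPf ij].
    by rewrite addr0 mulmxA vu eqxx scale1r ev.
  by rewrite mulmxA vu eq_sym ij scale0r mul0mx.
have Qbe b : coh b -> Q *m (b *m e) = b *m e.
  move=> /uspan [x ->]; rewrite mulmx_sumr; apply: eq_bigr => j _.
  by rewrite -scalemxAr Qu.
have ebQ b : coh b -> (e *m b) *m Q = e *m b.
  move=> cb; have /uspan[x hx] := coherent_adjoint cb.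
  have -> : e *m b = \sum_j (x j)^* *: adjointmx (u j).
    rewrite -[LHS]adjointmxK adjointmxM adje hx adjointmx_sum.
    by apply: eq_bigr => j _; rewrite adjointmxZ.
  rewrite mulmx_suml; apply: eq_bigr => j _; rewrite -scalemxAl uadj mulmx_suml.
  by congr (_ *: _); apply: eq_bigr => i _; rewrite -scalemxAl vQ.
have cQ : coh Q by apply: coherent_sum => i _; apply: (coherent_mul hc).
have QaQ1 b : coh b -> Q *m b *m Q = b *m Q.
  move=> cb; rewrite -mulmxA {2 3}/Q !mulmx_sumr; apply: eq_bigr => i _.
  by rewrite (mulmxA b) -(ue i) (mulmxA b) (mulmxA Q) Qbe //; apply: (coherent_mul hc).
have QaQ2 b : coh b -> Q *m b *m Q = Q *m b.
  move=> cb; rewrite {1 3}/Q !mulmx_suml; apply: eq_bigr => i _.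
  rewrite -!(mulmxA (u i)); congr (_ *m _); rewrite -(ev i) -!(mulmxA e) (mulmxA e) ebQ //.
  exact: (coherent_mul hc).
have c1 := @coherent1 _ _ _ _ _ hc C.
have zQ : coherent_central_idempotent c Q.
  split=> // [b cb|]; first by rewrite -QaQ2 // QaQ1.
  by have := QaQ1 _ c1; rewrite mulmx1 mul1mx.
have Q0 : Q != 0.
  by apply: contra e0 => /eqP Q0; rewrite -[e]mul1mx -(Qbe _ c1) Q0 mul0mx.
have PQ : P *m Q = Q.
  rewrite mulmx_sumr; apply: eq_bigr => i _; rewrite mulmxA; congr (_ *m _).
  have [_ zP' _] := zP; by rewrite /u mulmxA zP' // -mulmxA Pe.
have QP : Q = P.
  have [_ _ Pmin] := hP; have [_ _ QQ] := zQ; have [_ zQ' _] := zQ; have [cP _ _] := zP.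
  have := Pmin _ _ zQ (central_idempotentB zP zQ PQ).
  case; first by rewrite mulmxBr QQ zQ' // PQ subrr.
  - by rewrite addrC subrK.
  - by move/eqP: Q0.
  - by move/eqP; rewrite subr_eq0 => /eqP.
clearbody v; exists n, u, v; split=> // s i j.
(* In [A_s A_t e] the coefficients on the [A_r e] are entries of a product of 0-1 matrices, and each
   [A_r e] is a combination of the [u i] over [V]. *)
have cb : coh (A_ s *m A_ (enum_val j)) by apply: (coherent_mul hc).
have /choice [y hy] : forall r, exists y : 'I_n -> C,
    (forall i, V (y i)) /\ A_ r *m e = \sum_i y i *: u i.
  by move=> r; have [y Vy ->] := spanT r; rewrite sumT; exists (fun j => y (enum_val j)).
exists (\sum_r colorcoef c (A_ s *m A_ (enum_val j)) r * y r i).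
  apply: (subring_sum hV) => r _; apply: (subringM hV); last by case: (hy r).
  rewrite /colorcoef; case: pickP => [[x z] _|_]; last exact: (subring0 hV).
  rewrite mxE; apply: (subring_sum hV) => l _; rewrite !mxE.
  by apply: (subringM hV); apply: (subring_nat hV).
rewrite -mulmxA (mulmxA (A_ s)) {1}(coherent_sum_colormx cb) mulmx_suml mulmx_sumr scaler_suml.
apply: eq_bigr => r _; have [_ hr] := hy r.
rewrite -scalemxAl -scalemxAr hr mulmx_sumr -scalerA; congr (_ *: _).
rewrite (bigD1 i) //= big1 => [|l /negPf li];
  last by rewrite -scalemxAr vu eq_sym li scale0r scaler0.
by rewrite addr0 -scalemxAr vu eqxx scale1r.
Qed.

End MinimalRank.

Lemma matrix_units_exist P : prim P -> exists n e (u v : 'I_n -> 'M[C]_N), matrix_units P e u v.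
Proof.
move=> hP; have [[cP zP PP] P0 _] := hP.
pose ok r := `[< exists a, [/\ coh a, P *m a = a, a != 0 & \rank a = r] >].
have ex_ok : exists r, ok r by exists (\rank P); apply/asboolP; exists P.
case: (ex_minnP ex_ok) => r /asboolP [a [ca Pa a0 ra]] rmin.
have amin b : coh b -> P *m b = b -> b != 0 -> (\rank a <= \rank b)%N.
  by move=> cb Pb b0; rewrite ra rmin //; apply/asboolP; exists b.
have [e [ce Pe e0 ee [adje re]]] := minimal_rank_projection ca Pa a0 amin.
have [|n [u [v h]]] := matrix_units_of_projection hP ce Pe e0 ee adje; last by exists n, e, u, v.
by move=> b cb; apply: (minimal_rank_corner amin ce Pe ee re cb).
Qed.
End MatrixUnits.

(** * The coloring of a scheme *)

Section SchemeColoring.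
Variables (X : finType) (S : {set {set X * X}}).
Hypothesis hS : association_scheme S.
Local Notation N := #|X|.

Definition scheme_color (i j : 'I_N) : {set X * X} := finset.pblock S (enum_val i, enum_val j).
Local Notation c := scheme_color.

Let trivS : finset.trivIset S. Proof. by case/and3P: (scheme_partition hS). Qed.

Lemma scheme_color_mem i j : c i j \in S /\ (enum_val i, enum_val j) \in c i j.
Proof.
have hu : (enum_val i, enum_val j) \in finset.cover S.
  by rewrite (finset.cover_partition (scheme_partition hS)) inE.
by rewrite pblock_mem // finset.mem_pblock.
Qed.

Lemma scheme_colorE s i j : s \in S -> ((enum_val i, enum_val j) \in s) = (c i j == s).
Proof.
move=> Ss; apply/idP/eqP => [h|<-]; first exact: finset.def_pblock.
by case: (scheme_color_mem i j).
Qed.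

Lemma scheme_member_inhabited s : s \in S -> exists i j, c i j = s.
Proof.
move=> Ss; have /set0Pn [[x y] hxy] : s != finset.set0.
  by apply: contraTneq Ss => ->; case/and3P: (scheme_partition hS).
by exists (enum_rank x), (enum_rank y); apply/eqP; rewrite -scheme_colorE // !enum_rankK.
Qed.

Lemma scheme_regular_color r s i j i' j' : r \in S -> s \in S -> c i j = c i' j' ->
  #|[set l | (c i l == r) && (c l j == s)]| = #|[set l | (c i' l == r) && (c l j' == s)]|.
Proof.
move=> Sr Ss h; have [Sc mc] := scheme_color_mem i j; have [_ mc'] := scheme_color_mem i' j'.
rewrite -h in mc'.
have key x y : #|[set l | (c x l == r) && (c l y == s)]| = paths r s (enum_val x) (enum_val y).
  rewrite /paths -(card_imset _ (@enum_val_inj X xpredT)); apply: eq_card => z.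
  rewrite inE; apply/imsetP/idP => [[l]|hz].
    by rewrite inE => /andP[h1 h2] ->; rewrite !scheme_colorE ?h1.
  exists (enum_rank z); last by rewrite enum_rankK.
  by rewrite inE -!scheme_colorE // enum_rankK.
by rewrite !key (scheme_regular hS Sr Ss Sc mc mc').
Qed.

Lemma scheme_coloring : coherent_coloring c (diagonal_rel X) (@transpose X).
Proof.
split=> [i j|i j|r s i j i' j' h].
- rewrite -scheme_colorE ?(scheme_diagonal hS) // inE /=.
  by rewrite (inj_eq enum_val_inj).
- apply/eqP; have [Sc mc] := scheme_color_mem i j.
  by rewrite -scheme_colorE ?(scheme_transpose hS) // inE.
have notin t x y : (t \in S) = false -> (c x y == t) = false.
  by move=> nt; apply/eqP => ht; move: nt; rewrite -ht; case: (scheme_color_mem x y) => ->.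
case Sr: (r \in S); last by rewrite !eq_card0 // => l; rewrite !inE notin.
case Ss: (s \in S); last by rewrite !eq_card0 // => l; rewrite !inE (notin s) // andbF.
exact: scheme_regular_color.
Qed.

Lemma colormx_notin (R : pzRingType) s : s \notin S -> colormx c R s = 0.
Proof.
move=> nSs; apply/matrixP => i j; rewrite !mxE; case: eqP => // h.
by case/negP: nSs; rewrite -h; case: (scheme_color_mem i j).
Qed.

Lemma adjacency_matrixE (F : fieldType) s : s \in S -> adjacency_matrix F s = colormx c F s.
Proof. by move=> Ss; apply/matrixP => i j; rewrite !mxE scheme_colorE. Qed.

Lemma mem_adjacency_algebra (F : fieldType) (A : 'M[F]_N) :
  (A \in adjacency_algebra F S)%MS <-> coherent c A.
Proof.
split=> [/sub_sumsmxP [u hu]|hA].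
  have -> : A = \sum_(s in S) vec_mx (u s *m <<mxvec (adjacency_matrix F s)>>%MS).
    by rewrite -[LHS]mxvecK hu linear_sum.
  apply: coherent_sum => s Ss.
  have : (u s *m <<mxvec (adjacency_matrix F s)>>%MS <= mxvec (adjacency_matrix F s))%MS.
    by rewrite (submx_trans (submxMl _ _)) // genmxE.
  move=> /sub_rVP [a ->]; rewrite linearZ /= mxvecK adjacency_matrixE //.
  exact/coherentZ/coherent_colormx.
rewrite (coherent_sum_colormx hA) linear_sum summx_sub // => s _.
rewrite linearZ scalemx_sub //=; case Ss: (s \in S); last first.
  by rewrite colormx_notin ?Ss // linear0 sub0mx.
by rewrite -adjacency_matrixE // (sumsmx_sup s) // genmxE.
Qed.

Lemma central_idempotentE (C : numClosedFieldType) (e : 'M[C]_N) :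
  central_idempotent S e <-> coherent_central_idempotent c e.
Proof.
split=> [[]|[ce ze ee]].
  rewrite sub_capmx => /andP[/mem_adjacency_algebra ce /cent_mxP ze] ee.
  by split=> // A /mem_adjacency_algebra /ze.
split=> //; rewrite sub_capmx; apply/andP; split; first exact/mem_adjacency_algebra.
by apply/cent_mxP => A /mem_adjacency_algebra /ze.
Qed.

Lemma primitive_idempotentE (C : numClosedFieldType) (P : 'M[C]_N) :
  central_primitive_idempotents S P <-> coherent_primitive c P.
Proof.
split=> -[zP P0 Pmin].
  split=> //; first exact/central_idempotentE.
  by move=> e f /central_idempotentE ze /central_idempotentE zf; apply: Pmin.
split=> //; first exact/central_idempotentE.
by move=> e f /central_idempotentE ze /central_idempotentE zf; apply: Pmin.
Qed.

Lemma card_color_row i s : s \in S -> #|[set l | c i l == s]| = valency s.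
Proof.
move=> Ss; rewrite /valency /intersection_number;
  case: pickP => [[x y]|/(_ (enum_val i, enum_val i))]; last first.
  by rewrite inE eqxx.
rewrite inE => /= /eqP <-; rewrite -(enum_rankK x).
have hTs := scheme_transpose hS Ss; set k := enum_rank x.
have h := scheme_regular hS Ss hTs (scheme_diagonal hS) (u := (enum_val i, enum_val i))
   (v := (enum_val k, enum_val k)).
rewrite /= -h ?inE ?eqxx // /paths -(card_imset _ (@enum_val_inj X xpredT)); apply: eq_card => z.
rewrite inE; apply/imsetP/idP => [[l]|hz].
  by rewrite inE => hl ->; rewrite inE /= andbb scheme_colorE.
exists (enum_rank z); last by rewrite enum_rankK.
by rewrite inE -scheme_colorE // enum_rankK; case/andP: hz.
Qed.

(** The diagonal Gram matrix of the trace form; its determinant is the numerator of the Frame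
    number. *)
Lemma colormx_trace (F : fieldType) s t : s \in S -> t \in S ->
  \tr (colormx c F s *m (colormx c F t)^T) = ((s == t) * (N * valency s))%N%:R.
Proof.
move=> Ss St; have [<-|nst] := eqVneq s t; last first.
  rewrite mul0n /mxtrace big1 // => i _; rewrite mxE big1 // => l _; rewrite !mxE.
  have [hs|_] := eqVneq (c i l) s; last by rewrite mul0r.
  by have [ht|_] := eqVneq (c i l) t; rewrite ?mulr0 //; case/eqP: nst; rewrite -hs.
rewrite mul1n natrM -[N in N%:R]card_ord -sumr_const mulr_suml /mxtrace; apply: eq_big => // i _.
rewrite mul1r -(card_color_row i Ss) -sum1_card natr_sum mxE [RHS]big_mkcond /=.
apply: eq_bigr => l _; rewrite !mxE inE.
by case: eqP => _; rewrite ?mulr1 ?mulr0.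
Qed.

Lemma valency_gt0 s : s \in S -> (0 < valency s)%N.
Proof.
move=> Ss; have [i [j h]] := scheme_member_inhabited Ss.
by rewrite -(card_color_row i Ss) card_gt0; apply/set0Pn; exists j; rewrite inE h.
Qed.

Section Degree.
Variables (C : numClosedFieldType) (V : set C) (P e : 'M[C]_N) (n : nat) (u v : 'I_n -> 'M[C]_N).
Hypothesis hmu : matrix_units c V P e u v.

(** In column notation the rows are the vectors [u_i w]. For nonzero [w] fixed by [e] they form a
    basis of a submodule, on which [v_j] reads off the coordinate [j] as a multiple of [w]. *)
Definition orbit_mx (w : 'rV[C]_N) : 'M[C]_(n, N) := \matrix_i (w *m (u i)^T).

Lemma orbit_mx_v w x j : w *m e^T = w -> x *m orbit_mx w *m (v j)^T = x 0 j *: w :> 'rV_N.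
Proof.
move=> we; rewrite [x *m _]mulmx_sum_row mulmx_suml (bigD1 j) //= big1 => [|i /negPf ij].
  by rewrite addr0 rowK -scalemxAl -mulmxA -trmx_mul (mu_vu hmu) eqxx scale1r we.
by rewrite rowK -scalemxAl -mulmxA -trmx_mul (mu_vu hmu) eq_sym ij scale0r trmx0 mulmx0 scaler0.
Qed.

Lemma orbit_mx_rank w : w != 0 -> w *m e^T = w -> \rank (orbit_mx w) = n.
Proof.
move=> w0 we; suff /eqP : row_free (orbit_mx w) by [].
rewrite -kermx_eq0; apply/eqP/row_matrixP => k.
rewrite row0; set x := row k _; have hx : x *m orbit_mx w = 0 by apply/sub_kermxP; rewrite row_sub.
apply/rowP => j; have := orbit_mx_v x j we; rewrite hx mul0mx => /esym/eqP.
by rewrite scaler_eq0 (negPf w0) orbF => /eqP ->; rewrite [RHS]mxE.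
Qed.

Lemma submodule_coherent (L : 'M[C]_N) (A : 'M[C]_N) (x : 'rV_N) :
  submodule S L -> coherent c A -> (x <= L)%MS -> (x *m A^T <= L)%MS.
Proof.
move=> hL /mem_adjacency_algebra hA xL; apply: submx_trans (hL _ hA).
exact: submxMr.
Qed.

Lemma orbit_mx_submodule w : coherent_central_idempotent c P -> submodule S <<orbit_mx w>>%MS.
Proof.
move=> [cP zP PP] A /mem_adjacency_algebra cA; rewrite (eqmxMr _ (genmxE _)) genmxE.
apply/row_subP => i; rewrite row_mul rowK -mulmxA -trmx_mul -(mu_ue hmu i) mulmxA.
have -> : A *m u i *m e = \sum_j u j *m (v j *m A *m u i).
  have Pu : P *m u i = u i.
    rewrite -(mu_sum hmu) mulmx_suml (bigD1 i) //= big1 => [|j /negPf ji].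
      by rewrite addr0 -mulmxA (mu_vu hmu) eqxx scale1r (mu_ue hmu).
    by rewrite -mulmxA (mu_vu hmu) ji scale0r mulmx0.
  rewrite -mulmxA (mu_ue hmu) -{1}Pu mulmxA -zP // -{1}(mu_sum hmu) !mulmx_suml.
  by apply: eq_bigr => j _; rewrite !mulmxA.
rewrite linear_sum mulmx_sumr summx_sub // => j _.
have [t ht] : exists t, v j *m A *m u i = t *: e.
  have hcc := scheme_coloring.
  have cb' : coherent c (v j *m A *m u i).
    apply: (coherent_mul hcc); last exact: (mu_u hmu).
    by apply: (coherent_mul hcc) => //; apply: (mu_v hmu).
  have [t ht] := mu_corner hmu cb'; exists t; rewrite -ht -!mulmxA (mu_ue hmu) !mulmxA.
  by rewrite (mu_ev hmu).
rewrite ht -scalemxAr (mu_ue hmu) linearZ -scalemxAr scalemx_sub //.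
by rewrite -(rowK (fun j => w *m (u j)^T) j) row_sub.
Qed.

(** As [P] is the sum of the [u_j v_j] and acts as the identity on [L], some [v_j] does not kill [L]
    and produces a nonzero [w] in [L] fixed by [e]. The orbit of [w] is a submodule of dimension
    [n], which irreducibility identifies with [L]. *)
Lemma idempotent_degreeE : coherent_primitive c P -> idempotent_degree S P = n.
Proof.
move=> [zP P0 Pmin]; have hcc := scheme_coloring.
have ev j : (v j)^T *m e^T = (v j)^T by rewrite -trmx_mul (mu_ev hmu).
have sumT : \sum_j (v j)^T *m (u j)^T = P^T.
  by rewrite -(mu_sum hmu) linear_sum; apply: eq_bigr => j _; rewrite /= trmx_mul.
have orbit_sub w (L : 'M[C]_N) : submodule S L -> (w <= L)%MS -> (<<orbit_mx w>> <= L)%MS.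
  move=> hL wL; rewrite genmxE; apply/row_subP => i; rewrite rowK.
  by apply: submodule_coherent => //; apply: (mu_u hmu).
have sub_vn (L : 'M[C]_N) w : submodule S L -> w *m e^T = w -> (L <= orbit_mx w)%MS ->
    L != 0 -> (orbit_mx w <= L)%MS.
  move=> hL we Lw L0; have /rowV0Pn [y yL y0] := L0.
  have /submxP [x hx] := submx_trans yL Lw.
  have [j xj] : exists j, x 0 j != 0.
    by apply/rV0Pn; apply: contra y0 => /eqP x0; rewrite hx x0 mul0mx.
  rewrite -(genmxE (orbit_mx w)); apply: orbit_sub => //.
  rewrite -[w]scale1r -(mulVf xj) -scalerA -orbit_mx_v // scalemx_sub // -hx.
  by apply: submodule_coherent => //; apply: (mu_v hmu).
apply: xget_unique.
  have /rowV0Pn [w weT w0] : e^T != 0 by rewrite -mxrank_eq0 mxrank_tr mxrank_eq0 (mu_e0 hmu).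
    have we : w *m e^T = w.
      by have /submxP [z ->] := weT; rewrite -mulmxA -trmx_mul (mu_ee hmu).
    exists <<orbit_mx w>>%MS; split; last by rewrite genmxE orbit_mx_rank.
      split; first exact: orbit_mx_submodule.
        rewrite -mxrank_eq0 genmxE mxrank_eq0; apply: contra w0 => /eqP h0.
        have [j] : exists j : 'I_n, true.
          case: (n) u v hmu => [|n'] u' v' hmu'; last by exists ord0.
          by case/eqP: P0; rewrite -(mu_sum hmu') big_ord0.
        move=> _; have := orbit_mx_v (delta_mx 0 j) j we.
        by rewrite h0 mulmx0 mul0mx mxE !eqxx scale1r => <-.
      move=> U hU; rewrite genmxE => UL U0; rewrite genmxE; exact: sub_vn.
    have /submxP [z ->] : (<<orbit_mx w>> <= P^T)%MS.
      rewrite genmxE; apply/row_subP => i; rewrite rowK -(mu_ue hmu i).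
      have Pu : P *m u i = u i.
        rewrite -(mu_sum hmu) mulmx_suml (bigD1 i) //= big1 => [|j /negPf ji].
          by rewrite addr0 -mulmxA (mu_vu hmu) eqxx scale1r (mu_ue hmu).
        by rewrite -mulmxA (mu_vu hmu) ji scale0r mulmx0.
      by rewrite (mu_ue hmu) -Pu trmx_mul mulmxA submxMl.
    by case: zP => _ _ PP; rewrite /corresponds -mulmxA -trmx_mul PP.
move=> m [L [[hL L0 Lmin] LP <-]].
have [j hj] : exists j, L *m (v j)^T != 0.
  apply: contrapT => hn; case/eqP: L0; rewrite -LP -sumT mulmx_sumr big1 // => j _.
  rewrite mulmxA; apply/eqP; apply: contraT => h; exfalso; apply: hn; exists j.
  by apply: contra h => /eqP ->; rewrite mul0mx.
have /rowV0Pn [w wL w0] := hj.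
have we : w *m e^T = w by have /submxP [z ->] := wL; rewrite -!mulmxA ev.
have {}wL : (w <= L)%MS.
  have /submxP [z ->] := wL; rewrite mulmxA; apply: submodule_coherent (submxMl _ _) => //.
  exact: (mu_v hmu).
have o0 : <<orbit_mx w>>%MS != 0.
  rewrite -mxrank_eq0 genmxE orbit_mx_rank //; case: (n) u v hmu => // u' v' hmu'.
  by case/eqP: P0; rewrite -(mu_sum hmu') big_ord0.
have Lo := Lmin _ (orbit_mx_submodule _ zP) (orbit_sub _ _ hL wL) o0.
have oL := orbit_sub _ _ hL wL.
have -> : \rank L = \rank <<orbit_mx w>>%MS by apply: eqmx_rank; apply/andP.
by rewrite genmxE orbit_mx_rank.
Qed.

Lemma mu_trace i j : \tr (u i *m v j) = (i == j)%:R * (\rank e)%:R.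
Proof.
rewrite mxtrace_mulC (mu_vu hmu) linearZ /= (mxtrace_idempotent (mu_ee hmu)).
by rewrite eq_sym.
Qed.

(** [P] is the sum of the [n] idempotents [u i *m v i], each of trace [\rank e]. Hence the rank m_P
    is that of a primitive idempotent. *)
Lemma multiplicityE : coherent_primitive c P -> multiplicity S P = \rank e.
Proof.
move=> hP; rewrite /multiplicity idempotent_degreeE //.
have [[_ _ PP] P0 _] := hP.
have n0 : (0 < n)%N.
  case: (n) u v hmu => // u' v' hmu'.
  by case/eqP: P0; rewrite -(mu_sum hmu') big_ord0.
have /eqP : (\rank P)%:R = (n * \rank e)%N%:R :> C.
  rewrite -(mxtrace_idempotent PP) -(mu_sum hmu) linear_sum /= natrM.
  under eq_bigr do rewrite mu_trace eqxx mul1r.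
  by rewrite sumr_const card_ord mulr_natl.
by rewrite eqr_nat => /eqP ->; rewrite mulKn.
Qed.

End Degree.
End SchemeColoring.

(** * The Frame number *)

Lemma valuation_invmx (C : fieldType) (V : set C) (hV : subring_set V) n (M : 'M[C]_n) :
  (forall i j, V (M i j)) -> V (\det M)^-1 -> M \in unitmx -> forall i j, V (invmx M i j).
Proof.
move=> hM hd Mu i j; rewrite /invmx Mu !mxE; apply: (subringM hV) => //.
apply: (subringM hV); first by apply: (subringX hV); apply: (subringN hV); apply: (subring1 hV).
by apply: (subring_det hV) => a b; rewrite !mxE.
Qed.

(** Take [x = \det T * \det T']. If it is a unit of V then so is [\det T], the other factor being
    integral, and Cramer's rule bounds the inverse [Y]. The sizes differ formally because the two
    bases have different index types. *)
Lemma base_change_integral (C : fieldType) (V : set C) (hV : subring_set V) n1 n2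
    (T T' : 'M[C]_(n1, n2)) (Y : 'M[C]_(n2, n1)) (D : 'rV_n2) (G : 'rV_n1) :
  n1 = n2 -> T *m Y = 1%:M -> T *m diag_mx D *m T'^T = diag_mx G ->
  (forall i j, V (T i j)) -> (forall i j, V (T' i j)) ->
  exists x, [/\ V x, \prod_i G 0 i = x * \prod_i D 0 i &
                x != 0 -> V x^-1 -> forall i j, V (Y i j)].
Proof.
move=> n12; subst n2 => TY TDT hT hT'; exists (\det T * \det T'); split.
- by apply: (subringM hV); apply: (subring_det hV).
- by rewrite -!det_diag -TDT !det_mulmx det_tr mulrAC.
rewrite mulf_eq0 negb_or => /andP[T0 T'0] hx.
have Tu : T \in unitmx by rewrite unitmxE unitfE.
have -> : Y = invmx T by rewrite -[Y](mulKmx Tu) TY mulmx1.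
apply: (valuation_invmx hV) => //.
have -> : (\det T)^-1 = (\det T * \det T')^-1 * \det T' by rewrite invfM mulfVK.
by apply: (subringM hV) => //; apply: (subring_det hV).
Qed.

Section Frame.
Variables (X : finType) (S : {set {set X * X}}) (hS : association_scheme S).
Variables (C : numClosedFieldType) (V : set C) (hV : valuation_ring V).
Local Notation N := #|X|.
Local Notation c := (scheme_color S).
Local Notation prim := (@coherent_primitive N _ c C).
Local Notation A_ s := (colormx c C s).
Let hc := scheme_coloring hS.

Section Blocks.
Variables (h : nat) (P e : 'I_h -> 'M[C]_N) (n : 'I_h -> nat)
  (u v : forall l, 'I_(n l) -> 'M[C]_N).
Hypotheses (Pprim : forall l, prim (P l)) (Pinj : injective P) (sumP : \sum_l P l = 1%:M)
  (hmu : forall l, matrix_units c V (P l) (e l) (@u l) (@v l)).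

Local Notation J := {l : 'I_h & ('I_(n l) * 'I_(n l))%type}.
Definition block_index l (i j : 'I_(n l)) : J :=
  Tagged (fun l => ('I_(n l) * 'I_(n l))%type) (i, j).

Lemma big_blocks (R : Type) (idx : R) (op : Monoid.com_law idx) (F : J -> R) :
  \big[op/idx]_w F w = \big[op/idx]_l \big[op/idx]_(ij :
    'I_(n l) * 'I_(n l)) F (block_index ij.1 ij.2).
Proof.
rewrite (@sig_big_dep _ _ _ _ (fun l => ('I_(n l) * 'I_(n l))%type) xpredT (fun _ _ => true)
  (fun l ij => F (block_index ij.1 ij.2))).
by apply: eq_bigr => -[l [i j]].
Qed.

Definition block_unit (w : J) : 'M[C]_N := u (tagged w).1 *m v (tagged w).2.

(* [block_coef A (l, (i, j))] is the [(i, j)] entry of [A] in the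
   [l]-th irreducible representation. *)
Definition block_coef (A : 'M[C]_N) (w : J) : C :=
  \tr (v (tagged w).1 *m A *m u (tagged w).2) / (\rank (e (tag w)))%:R.

Lemma rank_e_neq0 l : (\rank (e l))%:R != 0 :> C.
Proof. by rewrite pnatr_eq0 mxrank_eq0 (mu_e0 (hmu l)). Qed.

Lemma block_coefE A l (i j : 'I_(n l)) : coherent c A ->
  v i *m A *m u j = block_coef A (block_index i j) *: e l.
Proof.
move=> cA; have hl := hmu l; have [t ht] : exists t, v i *m A *m u j = t *: e l.
  have cb : coherent c (v i *m A *m u j).
    apply: (coherent_mul hc); last exact: (mu_u hl).
    by apply: (coherent_mul hc) => //; apply: (mu_v hl).
  have [t ht] := mu_corner hl cb; exists t; rewrite -ht -!mulmxA (mu_ue hl) !mulmxA.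
  by rewrite (mu_ev hl).
by rewrite /block_coef /= ht linearZ /= (mxtrace_idempotent (mu_ee hl)) mulfK // rank_e_neq0.
Qed.

Lemma Pu l (i : 'I_(n l)) : P l *m u i = u i.
Proof.
have hl := hmu l; rewrite -(mu_sum hl) mulmx_suml (bigD1 i) //= big1 => [|j /negPf ji].
  by rewrite addr0 -mulmxA (mu_vu hl) eqxx scale1r (mu_ue hl).
by rewrite -mulmxA (mu_vu hl) ji scale0r mulmx0.
Qed.

Lemma vP l (i : 'I_(n l)) : v i *m P l = v i.
Proof.
have hl := hmu l; rewrite -(mu_sum hl) mulmx_sumr (bigD1 i) //= big1 => [|j /negPf ji].
  by rewrite addr0 mulmxA (mu_vu hl) eqxx scale1r (mu_ev hl).
by rewrite mulmxA (mu_vu hl) eq_sym ji scale0r mul0mx.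
Qed.

Lemma block_expansion A : coherent c A -> A = \sum_w block_coef A w *: block_unit w.
Proof.
move=> cA.
rewrite big_blocks -[LHS]mul1mx -sumP mulmx_suml; apply: eq_bigr => l _.
have [[_ zP PP] _ _] := Pprim l.
have -> : P l *m A = P l *m A *m P l by rewrite -mulmxA -zP // mulmxA PP.
rewrite -(mu_sum (hmu l)) !mulmx_suml.
under eq_bigr do rewrite mulmx_sumr.
rewrite pair_bigA /=; apply: eq_bigr => -[i j] _ /=.
rewrite !mulmxA -(mulmxA (u i) _ A) -(mulmxA (u i)) block_coefE //.
by rewrite -scalemxAr -scalemxAl (mu_ue (hmu l)).
Qed.

Lemma block_unit_free (x : J -> C) : \sum_w x w *: block_unit w = 0 -> forall w, x w = 0.
Proof.
move=> hx [l [a b]].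
have : v a *m (\sum_w x w *: block_unit w) *m u b = x (block_index a b) *: e l.
  rewrite mulmx_sumr mulmx_suml big_blocks /block_unit /= (bigD1 l) //= [X in _ + X]big1
    ?addr0; last first.
    move=> l' nl; apply: big1 => -[i j] _ /=.
    rewrite -(vP a) -(Pu i) -scalemxAr -scalemxAl !mulmxA -(mulmxA (v a)).
    rewrite (primitive_orthogonal hc (Pprim l) (Pprim l')) ?(inj_eq Pinj) 1?eq_sym //.
    by rewrite mulmx0 !mul0mx scaler0.
  have hl := hmu l.
  have term i j : v a *m (u i *m v j) *m u b = ((a == i)%:R * (j == b)%:R) *: e l.
    by rewrite mulmxA (mu_vu hl) -mulmxA (mu_vu hl) -scalemxAl -scalemxAr (mu_ee hl) scalerA.
  rewrite (bigD1 (a, b)) //= big1 => [|[i j] /=].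
    by rewrite addr0 -scalemxAr -scalemxAl term !eqxx mulr1 scale1r.
  rewrite xpair_eqE -scalemxAr -scalemxAl term (eq_sym i) => /nandP[]/negPf ->.
    by rewrite mul0r scale0r scaler0.
  by rewrite mulr0 scale0r scaler0.
rewrite hx mulmx0 mul0mx => /esym/eqP; rewrite scaler_eq0 (negPf (mu_e0 (hmu l))) orbF.
by move/eqP.
Qed.

Lemma block_coef_integral s w : V (block_coef (A_ s) w).
Proof.
case: w => l [i j]; have [x Vx hx] := mu_integral (hmu l) s i j.
have := hx; rewrite block_coefE; last exact: coherent_colormx.
move/eqP; rewrite -subr_eq0 -scalerBl scaler_eq0 (negPf (mu_e0 (hmu l))) orbF subr_eq0.
by move=> /eqP ->.
Qed.

(** Under the trace form the unit [(i, j)] is dual, up to [\rank (e l)], to the unit [(j, i)]. *)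
Definition block_swap (w : J) : J := block_index (tagged w).2 (tagged w).1.

Lemma block_trace A B : coherent c A -> coherent c B ->
  \tr (A *m B) = \sum_w block_coef A w * (\rank (e (tag w)))%:R * block_coef B (block_swap w).
Proof.
move=> cA cB; rewrite {1}(block_expansion cA) mulmx_suml linear_sum /=.
apply: eq_bigr => -[l [i j]] _; rewrite -scalemxAl linearZ /= -mulrA; congr (_ * _).
rewrite /block_unit /= -mulmxA mxtrace_mulC block_coefE // linearZ /=.
by rewrite (mxtrace_idempotent (mu_ee (hmu l))) mulrC.
Qed.

Let I := 'I_#|S|.
Let sv (i : I) : {set X * X} := enum_val i.
Let jv (j : 'I_#|{: J}|) : J := enum_val j.

Lemma coherent_sumS A : coherent c A -> A = \sum_(i : I) colorcoef c A (sv i) *: A_ (sv i).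
Proof.
move=> cA; rewrite {1}(coherent_sum_colormx cA) (bigID (mem S)) /= addrC big1 ?add0r.
  by rewrite big_enum_val.
by move=> s nSs; rewrite colormx_notin // scaler0.
Qed.

Lemma colormx_free (x : I -> C) : \sum_i x i *: A_ (sv i) = 0 -> forall i, x i = 0.
Proof.
move=> hx i; have [a [b hab]] := scheme_member_inhabited hS (enum_valP i : sv i \in S).
have := congr1 (fun M : 'M_N => M a b) hx; rewrite summxE (bigD1 i) //= big1 => [|j /negPf ji].
  by rewrite !mxE hab eqxx mulr1 addr0.
by rewrite !mxE hab (inj_eq enum_val_inj) eq_sym ji mulr0.
Qed.

Lemma frame_blocks :
  exists x, [/\ V x, (\prod_(s in S) (N * valency s))%N%:R =
                      x * \prod_l (\rank (e l))%:R ^+ (n l ^ 2)%N &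
    x != 0 -> V x^-1 -> forall l (i j : 'I_(n l)) a b, V ((u i *m v j) a b)].
Proof.
(* [T] holds the coordinates of the [A_s] in the matrix units, and [T'] those of their transposes,
   which are again adjacency matrices, with swapped indices. Thus [T D T'^T] is the Gram matrix of
   [tr (A B^T)], and both are integral. *)
pose T := \matrix_(i < #|S|, j < #|{: J}|) block_coef (A_ (sv i)) (jv j).
pose T' := \matrix_(i < #|S|, j < #|{: J}|) block_coef (A_ (sv i))^T (block_swap (jv j)).
have cu w : coherent c (block_unit w).
  by apply: (coherent_mul hc); [apply: (mu_u (hmu _))|apply: (mu_v (hmu _))].
pose Y := \matrix_(j < #|{: J}|, i < #|S|) colorcoef c (block_unit (jv j)) (sv i).
have cA s : coherent c (A_ s) by apply: coherent_colormx.
have sumJ (W : nmodType) (F : J -> W) : \sum_w F w = \sum_j F (jv j).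
  by rewrite (reindex jv) //; exists enum_rank => w _; rewrite /jv ?enum_valK ?enum_rankK.
have TY : T *m Y = 1%:M.
  apply/matrixP => i i'; apply/eqP; rewrite -subr_eq0; apply/eqP; move: i'.
  apply: colormx_free.
  under eq_bigr do rewrite scalerBl; rewrite sumrB; apply/eqP; rewrite subr_eq0; apply/eqP.
  rewrite [RHS](bigD1 i) //= [X in _ = _ + X]big1 ?addr0 => [|i' /negPf ii]; last first.
    by rewrite mxE eq_sym ii scale0r.
  rewrite mxE eqxx scale1r [RHS](block_expansion (cA _)) sumJ.
  under eq_bigr do rewrite mxE scaler_suml.
  rewrite exchange_big /=; apply: eq_bigr => j _.
  rewrite [in RHS](coherent_sumS (cu (jv j))) scaler_sumr; apply: eq_bigr => i' _.
  by rewrite !mxE scalerA.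
have YT : Y *m T = 1%:M.
  apply/matrixP => j j'; apply/eqP; rewrite -subr_eq0; apply/eqP.
  pose x w := (Y *m T) j (enum_rank w) - (1%:M : 'M_#|{: J}|) j (enum_rank w).
  have -> : (Y *m T) j j' - (1%:M : 'M_#|{: J}|) j j' = x (jv j') by rewrite /x /jv enum_valK.
  apply: block_unit_free; rewrite sumJ.
  under eq_bigr do rewrite /x /jv enum_valK scalerBl.
  rewrite sumrB; apply/eqP; rewrite subr_eq0; apply/eqP.
  rewrite [RHS](bigD1 j) //= [X in _ = _ + X]big1 ?addr0 => [|j'' /negPf jj]; last first.
    by rewrite mxE eq_sym jj scale0r.
  rewrite mxE eqxx scale1r [RHS](coherent_sumS (cu _)).
  under eq_bigr do rewrite mxE scaler_suml.
  rewrite exchange_big /=; apply: eq_bigr => i _.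
  rewrite [in RHS](block_expansion (cA _)) sumJ scaler_sumr; apply: eq_bigr => i' _.
  by rewrite !mxE scalerA.
(* The two bases have the same size, so |S| is the sum of the n_P^2 and [T] is square. *)
have eqIJ : #|S| = #|{: J}|.
  by apply/eqP; rewrite eqn_leq (mulmx1_min TY) (mulmx1_min YT).
pose D := \row_j (\rank (e (tag (jv j))))%:R : 'rV[C]_#|{: J}|.
pose G := \row_i (N * valency (sv i))%N%:R : 'rV[C]_#|S|.
have TDT : T *m diag_mx D *m T'^T = diag_mx G.
  apply/matrixP => i i'; have := colormx_trace hS C (enum_valP i) (enum_valP i').
  rewrite block_trace //; last exact: (coherentT hc).
  rewrite sumJ (inj_eq enum_val_inj) => htr.
  rewrite !mxE; transitivity ((((i == i') * (N * valency (enum_val i)))%N)%:R : C); last first.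
    by case: eqP => [->|_]; rewrite ?mul1n ?mulr1n ?mul0n.
  rewrite -htr; apply: eq_bigr => j _.
  by rewrite mul_mx_diag !mxE.
have hT i j : V (T i j) by rewrite mxE; apply: block_coef_integral.
have hT' i j : V (T' i j).
  have [a [b hab]] := scheme_member_inhabited hS (enum_valP i : sv i \in S).
  by rewrite mxE -hab (colormxT hc); apply: block_coef_integral.
have [x [Vx hx hY]] := base_change_integral hV eqIJ TY TDT hT hT'.
exists x; split=> //.
  transitivity (\prod_i G 0 i).
    by rewrite natr_prod big_enum_val; apply: eq_bigr => i _; rewrite mxE.
  rewrite hx; congr (_ * _); under eq_bigr do rewrite mxE.
  rewrite -(reindex (jv : _ -> J) (F := fun w => (\rank (e (tag w)))%:R) (P := xpredT)); last first.
    by exists enum_rank => w _; rewrite /jv ?enum_valK ?enum_rankK.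
  rewrite big_blocks; apply: eq_bigr => l _.
  transitivity (\prod_(ij in {: 'I_(n l) * 'I_(n l)}) ((\rank (e l))%:R : C)).
    exact: eq_bigl.
  by rewrite prodr_const card_prod card_ord mulnn.
move=> x0 hxV l i j a b.
pose w := block_index i j; rewrite -[u i *m v j]/(block_unit w).
rewrite (coherent_sumS (cu w)) summxE; apply: (subring_sum hV) => k _; rewrite !mxE.
apply: (subringM hV); last exact: (subring_nat hV).
by have := hY x0 hxV (enum_rank w) k; rewrite mxE /jv enum_rankK.
Qed.

End Blocks.
End Frame.

Section FrameNumber.
Variables (X : finType) (S : {set {set X * X}}) (hS : association_scheme S).
Variables (C : numClosedFieldType) (V : set C) (hV : valuation_ring V).
Local Notation N := #|X|.
Local Notation c := (scheme_color S).
Let hc := scheme_coloring hS.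

Lemma scheme_card_gt0 : (0 < N)%N.
Proof.
have [i _] := scheme_member_inhabited hS (scheme_diagonal hS).
exact: leq_ltn_trans (ltn_ord i).
Qed.

(** The Frame number leaves out the principal idempotent, whereas the determinants involve every
    block. Its factor is 1, as it has rank one. *)
Lemma frame_number_seq (L : seq 'M[C]_N) : uniq L ->
  (forall P, P \in L <-> coherent_primitive c P) ->
  frame_number C S = (\prod_(s in S) (N * valency s))%N%:R /
    \prod_(P <- L) ((multiplicity S P)%:R ^+ (idempotent_degree S P ^ 2)%N).
Proof.
move=> uL hL; rewrite /frame_number; congr (_%:R / _).
  by rewrite big_split /= prod_nat_const.
pose P0 := principal_idempotent C X.
have -> : nonprincipal_idempotents S = [set` [seq P <- L | P != P0]]%classic.
  apply/seteqP; split=> P /=.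
    move=> [/(primitive_idempotentE hS) /hL PL nP]; rewrite mem_filter PL andbT.
    by apply/eqP => h; apply: nP.
  rewrite mem_filter => /andP[nP PL]; split; first exact/(primitive_idempotentE hS)/hL.
  by move=> /= h; case/eqP: nP.
rewrite -fsbig_seq ?filter_uniq // big_filter big_mkcond /=.
rewrite big_seq [RHS]big_seq; apply: eq_bigr => P PL; case: eqP => //= PP0.
have hP := (hL P).1 PL; have [n [e [u [v hmu]]]] := matrix_units_exist hc hV hP.
rewrite (multiplicityE hS hmu) //.
suff -> : \rank e = 1%N by rewrite expr1n.
apply/eqP; rewrite eqn_leq lt0n mxrank_eq0 (mu_e0 hmu) andbT.
have Pr : (\rank P <= 1)%N.
  have -> : P = (const_mx (#|X|%:R^-1) : 'cV_N) *m (const_mx 1 : 'rV_N).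
    by rewrite PP0; apply/matrixP => i j; rewrite !mxE big_ord1 !mxE mulr1.
  by rewrite (leq_trans (mxrankM_maxr _ _)) // rank_leq_row.
rewrite -(multiplicityE hS hmu) // /multiplicity; apply: leq_trans _ Pr.
exact: leq_div.
Qed.

Lemma frame_number_valuation :
  V (ratr (frame_number C S)) /\
  forall P, coherent_primitive c P -> exists n e (u v : 'I_n -> 'M[C]_N),
    matrix_units c V P e u v /\
    (V (ratr (frame_number C S))^-1 -> forall i j a b, V ((u i *m v j) a b)).
Proof.
have [L [uL hL sL]] := primitive_list hc C.
pose P l := tnth (in_tuple L) l.
have Pprim l : coherent_primitive c (P l) by apply/hL; apply: mem_tnth.
have Pinj : injective P.
  move=> l l' /eqP; rewrite /P !(tnth_nth 0) nth_uniq // => /eqP.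
  exact: val_inj.
have sumP : \sum_l P l = 1%:M by have := sL; rewrite big_tnth.
have /choice [dt hdt] : forall l, exists dt : {n & ('M[C]_N * (('I_n -> 'M[C]_N) * ('I_n ->
  'M[C]_N)))%type},
    matrix_units c V (P l) (projT2 dt).1 (projT2 dt).2.1 (projT2 dt).2.2.
  move=> l; have [n [e [u [v h]]]] := matrix_units_exist hc hV (Pprim l).
  by exists (existT _ n (e, (u, v))).
have [x [Vx hx hxV]] := frame_blocks hS hV Pprim Pinj sumP hdt.
have num0 : (\prod_(s in S) (N * valency s))%N%:R != 0 :> C.
  rewrite pnatr_eq0 -lt0n prodn_cond_gt0 // => s Ss.
  by rewrite muln_gt0 scheme_card_gt0 (valency_gt0 hS Ss).
have x0 : x != 0 by apply: contra num0 => /eqP h; rewrite hx h mul0r.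
have Frx : ratr (frame_number C S) = x.
  rewrite (frame_number_seq uL hL) fmorph_div rmorph_nat [X in _ / X]rmorph_prod /= hx.
  rewrite [X in _ / X](_ : _ = \prod_l (\rank (projT2 (dt l)).1)%:R ^+ (projT1 (dt l) ^ 2)%N).
    rewrite mulfK //; apply: contra num0 => /eqP h; by rewrite hx h mulr0.
  rewrite big_tnth; apply: eq_bigr => l _.
  by rewrite rmorphXn rmorph_nat /= (multiplicityE hS (hdt l)) // (idempotent_degreeE hS (hdt l)).
rewrite Frx; split=> // Q /hL /seq_tnthP [l ->].
exists (projT1 (dt l)), (projT2 (dt l)).1, (projT2 (dt l)).2.1, (projT2 (dt l)).2.2.
by split=> [|xV i j a b]; [apply: hdt | apply: hxV].
Qed.
End FrameNumber.

(** * The field generated by the idempotents *)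

Section LinearCombinations.
Variables (Q L : fieldType) (h : {rmorphism Q -> L}).

(** [h] is abstract because it stands both for [ratr] into C and for the embedding of the prime
    field into [k]. *)
Definition lincomb d (e : 'I_d -> L) (a : 'rV[Q]_d) : L := \sum_i h (a 0 i) * e i.

Lemma lincomb_dependent m n (s : 'I_m -> L) (e : 'I_n -> L) :
  (forall i, exists a, e i = lincomb s a) -> (m < n)%N ->
  exists2 a, a != 0 & lincomb e a = 0.
Proof.
move=> /choice [M hM] lt_mn; pose A := \matrix_(i, j) M i 0 j.
have : kermx A != 0.
  rewrite kermx_eq0 /row_free neq_ltn (leq_ltn_trans _ lt_mn) //; exact: rank_leq_col.
move=> /rowV0Pn [a /sub_kermxP aA a0]; exists a => //.
rewrite /lincomb; under eq_bigr do rewrite hM /lincomb mulr_sumr.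
rewrite exchange_big big1 // => j _ /=.
under eq_bigr do rewrite mulrA -rmorphM.
rewrite -mulr_suml -rmorph_sum /=; have := congr1 (fun B : 'rV_m => B 0 j) aA.
rewrite !mxE => hj; rewrite [X in h X](_ : _ = 0) ?rmorph0 ?mul0r // -[RHS]hj.
by apply: eq_bigr => i _; rewrite ?mxE.
Qed.

Lemma lincomb_recl d (e : 'I_d.+1 -> L) a :
  lincomb e a = h (a 0 ord0) * e ord0 +
    lincomb (fun i => e (lift ord0 i)) (\row_i a 0 (lift ord0 i)).
Proof. by rewrite /lincomb big_ord_recl; congr (_ + _); apply: eq_bigr => i _; rewrite mxE. Qed.

(** A largest free family in [K] exists by the bound [m]. Adjoining [z] makes it dependent, with a
    nonzero coefficient on [z], which can then be solved for. *)
Lemma maximal_free_family (K : set L) m :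
  (forall e : 'I_m.+1 -> L, (forall i, K (e i)) -> exists2 a, a != 0 & lincomb e a = 0) ->
  exists d (e : 'I_d -> L), [/\ (d <= m)%N, forall i, K (e i) &
    forall z, K z -> exists! a : 'rV[Q]_d, z = lincomb e a].
Proof.
move=> dep.
pose free d := exists2 e : 'I_d -> L, forall i, K (e i) & forall a, lincomb e a = 0 -> a = 0.
have freeS d : free d.+1 -> free d.
  move=> [e Ke he]; exists (fun i => e (lift ord0 i)) => // a ha.
  pose b := \row_j (if unlift ord0 j is Some i then a 0 i else 0) : 'rV[Q]_d.+1.
  have ba : \row_i b 0 (lift ord0 i) = a by apply/rowP => i; rewrite !mxE liftK.
  have hb : lincomb e b = 0 by rewrite lincomb_recl ba ha mxE unlift_none rmorph0 mul0r addr0.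
  by rewrite -ba (he _ hb); apply/rowP => i; rewrite !mxE.
have nfree : ~ free m.+1.
  by move=> [e Ke he]; have [a a0 /he/eqP] := dep e Ke; rewrite (negPf a0).
have free_le d : free d -> (d <= m)%N.
  rewrite leqNgt => fd; apply/negP => md; apply: nfree.
  elim: d md fd => // d IHd; rewrite ltnS leq_eqVlt => /orP[/eqP ->|/IHd hd /freeS] //.
have f0 : free 0%N by exists (fun=> 0) => [[]//|a _]; rewrite [a]thinmx0.
have ex_free : exists d, `[< free d >] by exists 0%N; apply/asboolP.
have [d /asboolP [e Ke he] dmax] := @ex_maxnP (fun d => `[< free d >]) m ex_free
  (fun d fd => free_le d (asboolW fd)).
exists d, e; split=> //; first by apply: free_le; exists e.
move=> z Kz; pose e1 j := if unlift ord0 j is Some i then e i else z.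
have e1E b : lincomb e1 b = h (b 0 ord0) * z + lincomb e (\row_i b 0 (lift ord0 i)).
  rewrite lincomb_recl {1}/e1 unlift_none; congr (_ + _); apply: eq_bigr => i _.
  by rewrite /e1 liftK.
have uniq_a a b : lincomb e a = lincomb e b -> a = b.
  move=> hab; apply/eqP; rewrite -subr_eq0; apply/eqP/he.
  rewrite -(subrr (lincomb e b)) -{1}hab /lincomb -sumrB; apply: eq_bigr => i _.
  by rewrite !mxE rmorphB mulrBl.
have [b b0 hb] : exists2 b, b != 0 & lincomb e1 b = 0.
  apply: contrapT => hn; have /asboolP/dmax : free d.+1.
    exists e1 => [j|b hb]; first by rewrite /e1; case: unlift.
    by apply: contrapT => /eqP b0; apply: hn; exists b.
  by rewrite ltnn.
have c0 : b 0 ord0 != 0.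
  apply: contra b0 => /eqP c0; move: hb; rewrite e1E c0 rmorph0 mul0r add0r => /he hb.
  apply/eqP/rowP => j; rewrite mxE; case: (unliftP ord0 j) => [i ->|-> //].
  by have := congr1 (fun r : 'rV_d => r 0 i) hb; rewrite !mxE.
have hz : z = lincomb e (\row_i (- (b 0 ord0)^-1 * b 0 (lift ord0 i))).
  have hc : h (b 0 ord0) != 0 by rewrite fmorph_eq0.
  apply: (mulfI hc); move: hb; rewrite e1E => /eqP; rewrite addr_eq0 => /eqP ->.
  rewrite /lincomb mulr_sumr -sumrN; apply: eq_bigr => i _.
  by rewrite !mxE mulrA -rmorphM mulrA mulrN mulfV // mulN1r rmorphN mulNr.
by eexists; split; [exact: hz|move=> a; rewrite {1}hz => /uniq_a].
Qed.

End LinearCombinations.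

Section FiniteDegree.
Variable C : numClosedFieldType.

Definition rat_subring (W : set C) := subring_set W /\ forall x : rat, W (ratr x).

Definition in_rat_span (I : finType) (s : I -> C) : set C :=
  [set z | exists a : I -> rat, z = \sum_i ratr (a i) * s i]%classic.

Definition finite_rat_span (W : set C) :=
  exists (I : finType) (s : I -> C), forall z, W z -> in_rat_span s z.

Lemma in_rat_span_sum (I : finType) (s : I -> C) (J : Type) (r : seq J) (F : J -> C) :
  (forall j, in_rat_span s (F j)) -> in_rat_span s (\sum_(j <- r) F j).
Proof.
move=> hF; apply: big_ind => // [|x y [a ->] [b ->]].
  by exists (fun=> 0); rewrite big1 // => i _; rewrite rmorph0 mul0r.
by exists (fun i => a i + b i); rewrite -big_split; apply: eq_bigr => i _; rewrite rmorphD mulrDl.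
Qed.

(** [q] rewrites [a ^+ m], for [m] its degree, in lower powers; induction on the exponent leaves
    only the powers below [m]. *)
Lemma adjoin_finite_rat_span (W : set C) a (q : {poly rat}) :
  rat_subring W -> finite_rat_span W -> q \is monic -> root (map_poly ratr q) a ->
  finite_rat_span [set z | exists2 f, poly_over W f & z = f.[a]]%classic.
Proof.
move=> [sW ratW] [I [s hs]] qm qa; pose m := (size q).-1.
have qs : size q = m.+1 by rewrite prednK // lt0n size_poly_eq0 monic_neq0.
pose s' (ij : I * 'I_m) := s ij.1 * a ^+ ij.2.
have am : a ^+ m = - \sum_(j < m) ratr q`_j * a ^+ j.
  move: qa; rewrite rootE horner_coef size_map_poly qs big_ord_recr /= !coef_map /=.
  rewrite -[q`_m]/(q`_(m.+1).-1) -qs -/(lead_coef q) (monicP qm) rmorph1 mul1r addrC addr_eq0.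
  by move=> /eqP ->; congr (- _); apply: eq_bigr => j _; rewrite coef_map.
have pow n w : W w -> in_rat_span s' (w * a ^+ n).
  elim/ltn_ind: n w => n IHn w Ww; case: (ltnP n m) => [lt_nm|le_mn].
    have [b ->] := hs _ Ww.
    exists (fun ij => if ij.2 == Ordinal lt_nm then b ij.1 else 0).
    rewrite -(pair_bigA _ (fun i j => ratr (if j == Ordinal lt_nm then b i else 0) * s' (i, j))) /=.
    rewrite mulr_suml; apply: eq_bigr => i _; rewrite (bigD1 (Ordinal lt_nm)) //= eqxx.
    rewrite big1 ?addr0 ?mulrA // => j /negPf ->; by rewrite rmorph0 mul0r.
  rewrite -(subnK le_mn) exprD am mulrN mulrN -mulNr mulr_sumr mulr_sumr.
  apply: in_rat_span_sum => j.
  have -> : - w * (a ^+ (n - m) * (ratr q`_j * a ^+ j)) = (- w * ratr q`_j) * a ^+ (n - m + j).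
    by rewrite exprD; ring.
  apply: IHn; last by apply: (subringM sW) => //; apply: (subringN sW).
  by rewrite -[ltnRHS](subnK le_mn) ltn_add2l.
exists (I * 'I_m)%type, s' => z [f hf ->]; rewrite horner_coef.
by apply: in_rat_span_sum => j; apply: pow.
Qed.

Lemma algebraic_rat_subring (r : seq C) :
  (forall z, z \in r -> exists2 q : {poly rat}, q \is monic & root (map_poly ratr q) z) ->
  exists W, [/\ rat_subring W, finite_rat_span W & forall z, z \in r -> W z].
Proof.
elim: r => [|a r IHr] hr.
  exists [set z | exists x : rat, z = ratr x]%classic; split=> //.
    split=> [|x]; last by exists x.
    split=> [|x y [a ->] [b ->]|x y [a ->] [b ->]].
    - by exists 1; rewrite rmorph1.
    - by exists (a - b); rewrite rmorphB.
    - by exists (a * b); rewrite rmorphM.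
  by exists unit, (fun=> 1) => z [x ->]; exists (fun=> x); rewrite (big_pred1 tt) ?mulr1 // => -[].
have [z zr|W [[sW ratW] fW hW]] := IHr; first by apply: hr; rewrite inE zr orbT.
have [q qm qa] := hr a (mem_head _ _).
exists [set z | exists2 f, poly_over W f & z = f.[a]]%classic.
have Wadj x : W x -> exists2 f, poly_over W f & x = f.[a].
  by move=> Wx; exists x%:P; rewrite ?hornerC //; apply: poly_overC.
split.
- by split=> [|x]; [apply: adjoin_subring|apply: Wadj].
- exact: (adjoin_finite_rat_span _ _ qm qa).
- move=> z; rewrite inE => /predU1P[->|/hW]; last exact: Wadj.
  by exists 'X; rewrite ?hornerX // -['X]expr1; apply: poly_overXn.
Qed.

Lemma lincomb_span (I : finType) (s : I -> C) z : in_rat_span s z ->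
  exists a, z = lincomb (ratr : {rmorphism rat -> C}) (fun j : 'I_#|I| => s (enum_val j)) a.
Proof.
move=> [a ->]; exists (\row_j a (enum_val j)); rewrite /lincomb (reindex (enum_val : 'I_#|I| -> I)).
  by apply: eq_bigr => j _; rewrite mxE.
by exists enum_rank => w _; rewrite ?enum_valK ?enum_rankK.
Qed.

(** The powers of [z] are linearly dependent. Removing factors ['X] from the relation gives it a
    nonzero constant term, and then [z^-1] is a polynomial in [z]. *)
Lemma rat_subring_inv (W : set C) : rat_subring W -> finite_rat_span W ->
  forall z, W z -> W z^-1.
Proof.
move=> [sW ratW] [I [s hs]] z Wz; have [->|z0] := eqVneq z 0.
  by rewrite invr0; apply: (subring0 sW).
have [a a0 ha] := @lincomb_dependent _ _ (ratr : {rmorphism rat -> C}) _ _ _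
  (fun j : 'I_#|I|.+1 => z ^+ j) (fun j => lincomb_span (hs _ (subringX sW j Wz))) (ltnSn _).
pose q := \poly_(j < #|I|.+1) a 0 (inord j).
have q0 : q != 0.
  apply: contra a0 => /eqP q0; apply/eqP/rowP => j; have := congr1 (fun f : {poly rat} => f`_j) q0.
  by rewrite coef_poly ltn_ord inord_val coef0 mxE.
have qz : root (map_poly ratr q) z.
  rewrite rootE (horner_coef_wide _ (_ : (_ <= #|I|.+1)%N));
    last by rewrite size_map_poly size_poly.
  rewrite -[X in _ == X]ha; apply/eqP/eq_bigr => j _.
  by rewrite coef_map coef_poly ltn_ord inord_val.
move: q q0 qz; elim/poly_ind => [|q x IHq]; first by rewrite eqxx.
move=> qx0; rewrite rootE rmorphD rmorphM /= map_polyX map_polyC /= !hornerE.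
have [x0|x0] := eqVneq x 0.
  rewrite x0 rmorph0 !addr0 mulf_eq0 (negPf z0) orbF; apply: IHq.
  by apply: contra qx0 => /eqP ->; rewrite x0 mul0r addr0.
rewrite addr_eq0 => /eqP h.
have -> : z^-1 = - ratr x^-1 * (map_poly ratr q).[z].
  by apply: (mulIf z0); rewrite mulVf // -mulrA h mulrNN -rmorphM mulVf // rmorph1 //.
apply: (subringM sW); first by apply: (subringN sW).
by apply: (poly_over_horner sW) => // i; rewrite coef_map /=; apply: ratW.
Qed.

(** Determinants of [(X - A)(X - B) = X (X - (A + B))]. *)
Lemma char_poly_orthogonal n (A B : 'M[C]_n) : A *m B = 0 ->
  char_poly A * char_poly B = 'X^n * char_poly (A + B).
Proof.
move=> AB0; rewrite /char_poly -det_mulmx -(det_scalar n 'X) -det_mulmx; congr (\det _).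
rewrite /char_poly_mx map_mxD.
have ab : map_mx polyC A *m map_mx polyC B = 0 by rewrite -map_mxM AB0 map_mx0.
move: (map_mx polyC A) (map_mx polyC B) ab => a b ab.
by rewrite mulmxBl !(mulmxBr, mulmxDr) (scalar_mxC _ a) ab subr0 opprD addrA addrAC.
Qed.

(* [P M] and [(1 - P) M] are orthogonal with sum [M], so the eigenvalues of [P M]
   are among those of [M] and [0]. *)
Lemma idempotent_mxtrace n (P M : 'M[C]_n) (W : set C) : subring_set W ->
  P *m P = P -> P *m M = M *m P -> (forall z, root (char_poly M) z -> W z) -> W (\tr (P *m M)).
Proof.
move=> sW PP PM hW; pose A := P *m M; pose B := M - A.
have PMP : P *m M *m P = P *m M by rewrite -mulmxA -PM mulmxA PP.
have AB0 : A *m B = 0 by rewrite mulmxBr /A (mulmxA _ P) PMP subrr.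
have key : char_poly A * char_poly B = 'X^n * char_poly M.
  by rewrite char_poly_orthogonal // /B addrC subrK.
have [r hr ->] := char_poly_split A; rewrite big_seq; apply: (subring_sum sW) => z zr.
have : root ('X^n * char_poly M) z by rewrite -key rootM hr root_prod_XsubC zr.
rewrite rootM => /orP[|/hW//]; rewrite rootE hornerXn expf_eq0 => /andP[_ /eqP ->].
exact: (subring0 sW).
Qed.

End FiniteDegree.

Lemma scheme_field_closed (C : numClosedFieldType) (X : finType) (S : {set {set X * X}}) :
  [/\ subring_set (scheme_field C S),
      forall z, scheme_field C S z -> scheme_field C S z^-1 &
      forall P i j, central_primitive_idempotents S P -> scheme_field C S (P i j)].
Proof.
have closed (K : set C) : GRing.divring_closed (mem K) ->
    [/\ K 1, forall x y, K x -> K y -> K (x - y) & forall x y, K x -> K y -> K (x / y)].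
  move=> [h1 hB hV]; split=> [|x y /mem_set hx /mem_set hy|x y /mem_set hx /mem_set hy].
  - by have := set_mem h1.
  - by have := set_mem (hB _ _ hx hy).
  - by have := set_mem (hV _ _ hx hy).
have invK (K : set C) : GRing.divring_closed (mem K) -> forall y, K y -> K y^-1.
  by move=> /closed [h1 _ hV] y hy; rewrite -[y^-1]mul1r; apply: hV.
split.
- split=> [K [/closed [] //]|x y hx hy K [hK hE]|x y hx hy K [hK hE]].
    by have [_ hB _] := closed _ hK; apply: hB; [apply: hx|apply: hy].
  have [_ _ hV] := closed _ hK; rewrite -[y]invrK; apply: hV; first exact: hx.
  by apply: invK => //; apply: hy.
- by move=> z hz K [hK hE]; apply: invK => //; apply: hz.
- by move=> P i j hP K [hK hE]; apply: hE; exists P, i, j.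
Qed.

(** The eigenvalues of the adjacency matrices are roots of rational characteristic polynomials, so
    they lie in a subring of finite dimension over the rationals, which turns out to contain all
    entries of the idempotents. Hence [degree_over_rat] is a genuine degree here and not the default
    of [xget]. *)
Lemma scheme_field_finite_degree (C : numClosedFieldType) (X : finType) (S : {set {set X * X}}) :
  association_scheme S ->
  exists e : 'I_(degree_over_rat (scheme_field C S)) -> C, rat_basis (scheme_field C S) e.
Proof.
move=> hS; pose K := scheme_field C S; pose c := scheme_color S.
have hc := scheme_coloring hS.
suff [W [rW fW KW]] : exists W : set C, [/\ rat_subring W, finite_rat_span W & (K `<=` W)%classic].
  have [I [s hs]] := fW;
    apply: (@xgetPex _ 0%N [set d | exists e : 'I_d -> C, rat_basis K e]%classic).
  have [e Ke|d [e [_ Ke he]]] :=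
      @maximal_free_family _ _ (ratr : {rmorphism rat -> C}) K #|I|; last by exists d, e.
  apply: (lincomb_dependent (s := fun j : 'I_#|I| => s (enum_val j))) => // i.
  by apply: lincomb_span; apply/hs/KW.
pose M s : 'M[C]_#|X| := (colormx c C s)^T.
have /choice [rt hrt] : forall s, exists r : seq C, char_poly (M s) = \prod_(z <- r) ('X - z%:P).
  by move=> s; have [r hr _] := char_poly_split (M s); exists r.
have [z /flatten_mapP [s _ zs]|W [rW fW hW]] :=
    @algebraic_rat_subring C (flatten [seq rt s | s <- enum {: {set X * X}}]).
  exists (char_poly ((colormx c rat s)^T)); first exact: char_poly_monic.
  have -> : map_poly ratr (char_poly (colormx c rat s)^T) = char_poly (M s) :> {poly C}.
    rewrite map_char_poly; congr char_poly; apply/matrixP => i j.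
    by rewrite !mxE rmorph_nat.
  by rewrite hrt root_prod_XsubC.
exists W; split=> //; have [sW ratW] := rW.
apply: smallest_sub.
  have [h1 hB hM] := sW.
  split=> [|x y /set_mem hx /set_mem hy|x y /set_mem hx /set_mem hy]; apply: mem_set => //.
    exact: hB.
  by apply: hM => //; apply: rat_subring_inv.
move=> _ [P [i [j [/(primitive_idempotentE hS) [[cP zP PP] _ _] ->]]]].
(* Pairing [P] with the adjacency matrix of [s] adds up [N] entries of [P], all equal to [P i j]. An
   entry is thus a trace, up to a rational factor. *)
pose s := c i j; pose N := \sum_k \sum_l (c k l == s : nat).
have N0 : N%:R != 0 :> C by rewrite pnatr_eq0 /N (bigD1 i) //= (bigD1 j) //= eqxx.
have trP : \tr (P *m M s) = N%:R * P i j.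
  rewrite /mxtrace natr_sum mulr_suml; apply: eq_bigr => k _; rewrite mxE natr_sum mulr_suml.
  apply: eq_bigr => l _; rewrite !mxE -/c; case: eqP => [h|_]; rewrite ?mulr0 ?mul0r //.
  by rewrite mulr1 mul1r; apply: cP.
have -> : P i j = ratr N%:R^-1 * \tr (P *m M s).
  by rewrite trP fmorphV rmorph_nat mulKf.
apply: (subringM sW) => //; apply: idempotent_mxtrace => //.
  by apply: zP; apply: (coherentT hc); apply: coherent_colormx.
move=> z; rewrite hrt root_prod_XsubC => zs; apply: hW.
by apply/flatten_mapP; exists s => //; rewrite mem_enum.
Qed.

(** * The residue field of a number field *)

Section ResidueSubfield.
Variables (C : numClosedFieldType) (V : set C) (p : nat).
Hypotheses (p_prime : prime p) (hV : valuation_ring V) (Vp : ~ V (p%:R)^-1).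
Variables (O : comNzRingType) (i : {rmorphism O -> C}) (k : fieldType) (f : {rmorphism O -> k}).
Hypotheses (i_inj : injective i) (iV : forall x, V x <-> exists o, i o = x)
  (f_unit : forall o, f o != 0 -> exists o', o' * o = 1).
Variable K : set C.
Hypotheses (sK : subring_set K) (KV : forall z, K z -> K z^-1).

Definition residue_subfield_pred of subring_set K & (forall z, K z -> K z^-1)
    & (forall o, f o != 0 -> exists o', o' * o = 1) : {pred k} :=
  fun y => `[< exists2 o, f o = y & K (i o) >].
Local Notation pF := (residue_subfield_pred sK KV f_unit).

Lemma residue_subfield_closed : divring_closed pF.
Proof.
split.
- by apply/asboolP; exists 1; rewrite rmorph1 //; apply: (subring1 sK).
- move=> _ _ /asboolP [o <- Ko] /asboolP [o' <- Ko']; apply/asboolP.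
  by exists (o - o'); rewrite rmorphB //; apply: (subringB sK).
- move=> _ _ /asboolP [o <- Ko] /asboolP [o' <- Ko']; apply/asboolP.
  have [->|fo'] := eqVneq (f o') 0.
    by exists 0; rewrite ?invr0 ?mulr0 rmorph0 //; apply: (subring0 sK).
  have [u hu] := f_unit fo'; exists (o * u).
    rewrite rmorphM; congr (_ * _); apply: (mulIf fo').
    by rewrite -rmorphM hu rmorph1 mulVf.
  rewrite rmorphM; apply: (subringM sK) => //.
  have -> : i u = (i o')^-1; last exact: KV.
  have iuo : i u * i o' = 1 by rewrite -rmorphM hu rmorph1.
  have io' : i o' != 0 by apply/eqP => h0; move/eqP: iuo; rewrite h0 mulr0 eq_sym oner_eq0.
  by apply: (mulIf io'); rewrite iuo mulVf.
Qed.
HB.instance Definition _ := GRing.isDivringClosed.Build k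
  (residue_subfield_pred sK KV f_unit) residue_subfield_closed.

Record residue_subfield := ResidueSubfield { rsval : k; _ : rsval \in pF }.
HB.instance Definition _ := [isSub for rsval].
HB.instance Definition _ := [Choice of residue_subfield by <:].
HB.instance Definition _ := [SubChoice_isSubIntegralDomain of residue_subfield by <:].
HB.instance Definition _ := [SubIntegralDomain_isSubField of residue_subfield by <:].

Lemma pchar_residue : p \in [pchar k].
Proof.
rewrite inE p_prime /=; apply/eqP; apply: contrapT => /eqP p0.
have [o] : exists o', o' * p%:R = 1 :> O by apply: f_unit; rewrite rmorph_nat.
move=> ho; apply: Vp; apply/iV; exists o.
have pC : p%:R != 0 :> C by rewrite pnatr_eq0 -lt0n prime_gt0.
by apply: (mulIf pC); rewrite mulVf // -(rmorph_nat i) -rmorphM ho rmorph1.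
Qed.

Variables (d : nat) (e : 'I_d -> C).
Hypothesis he : rat_basis K e.

Lemma int_residue_eq0 (z : int) : (z%:~R == 0 :> k) = (p %| `|z|)%N.
Proof. by rewrite (dvdn_pcharf pchar_residue); case: z => n;
  rewrite ?NegzE ?mulrNz ?oppr_eq0 ?abszN. Qed.

Definition prime_field_hom of p \in [pchar k] : 'F_p -> k := fun x => (x : nat)%:R.
Local Notation hp := (prime_field_hom pchar_residue).

Lemma prime_field_hom_nat n : hp n%:R = n%:R.
Proof. by rewrite /prime_field_hom val_Fp_nat // (GRing.natr_mod_pchar pchar_residue). Qed.

Lemma prime_field_hom_zmod : zmod_morphism hp.
Proof.
have hD x y : hp (x + y) = hp x + hp y.
  by rewrite -[x]natr_Zp -[y]natr_Zp -natrD !prime_field_hom_nat natrD.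
by move=> x y; apply/eqP; rewrite eq_sym subr_eq -hD subrK.
Qed.

Lemma prime_field_hom_monoid : monoid_morphism hp.
Proof.
split=> [|x y]; first exact: (prime_field_hom_nat 1).
by rewrite -[x]natr_Zp -[y]natr_Zp -natrM !prime_field_hom_nat natrM.
Qed.
HB.instance Definition _ := GRing.isZmodMorphism.Build _ _ (prime_field_hom pchar_residue)
  prime_field_hom_zmod.
HB.instance Definition _ := GRing.isMonoidMorphism.Build _ _ (prime_field_hom pchar_residue)
  prime_field_hom_monoid.

(** If [p] divided the denominator, reducing [o * denq x = numq x] would make it divide the
    numerator as well. *)
Lemma rat_residue (x : rat) o : i o = ratr x -> exists a, f o = hp a.
Proof.
move=> hx; have ho : o * (denq x)%:~R = (numq x)%:~R.
  apply: i_inj; rewrite rmorphM hx !rmorph_int -(ratr_int _ (denq x)) -rmorphM.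
  by rewrite -numqE rmorph_int.
have hk : f o * (denq x)%:~R = (numq x)%:~R by rewrite -!(rmorph_int f) -rmorphM ho.
have [d0|d0] := eqVneq ((denq x)%:~R : k) 0.
  move: hk; rewrite d0 mulr0 => /esym/eqP; rewrite int_residue_eq0.
  move/eqP: d0; rewrite int_residue_eq0 => pd pn.
  have : (p %| gcdn `|numq x| `|denq x|)%N by rewrite dvdn_gcd pn pd.
  by rewrite (eqP (coprime_num_den x)) dvdn1 => /eqP hp1; have := prime_gt1 p_prime; rewrite {1}hp1.
exists ((numq x)%:~R / (denq x)%:~R); rewrite fmorph_div !rmorph_int.
by apply: (mulIf d0); rewrite hk divfK.
Qed.

(** Lifts to [K] satisfy a rational relation. Divided by its dominant coefficient, it has
    coefficients in V, one of them equal to 1, and its reduction is nontrivial. *)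
Lemma residue_subfield_dependent (y : 'I_d.+1 -> k) : (forall j, pF (y j)) ->
  exists2 a : 'rV['F_p]_d.+1, a != 0 & lincomb hp y a = 0.
Proof.
move=> hy; have [Ke espan] := he.
have /choice [o ho] : forall j, exists o, f o = y j /\ K (i o).
  by move=> j; have /asboolP [o] := hy j; exists o.
have [a a0 ha] : exists2 a : 'rV[rat]_d.+1, a != 0 &
    lincomb (ratr : {rmorphism rat -> C}) (fun j => i (o j)) a = 0.
  apply: (lincomb_dependent (s := e)) => // j.
  by have [b [hb _]] := espan _ (ho j).2; exists b.
have [j1 aj1] : exists j, a 0 j != 0 by apply/rV0Pn.
have : has (fun x => x != 0) [seq (ratr (a 0 j) : C) | j <- enum 'I_d.+1].
  by apply/hasP; exists (ratr (a 0 j1)); rewrite ?fmorph_eq0 //; apply/map_f; rewrite mem_enum.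
move=> /(valuation_dominant hV) [_ [/mapP [j0 _ ->]]]; rewrite fmorph_eq0 => aj0 hdom.
have /choice [b hb] : forall j, exists b, i b = ratr (a 0 j / a 0 j0).
  by move=> j; apply/iV; rewrite fmorph_div; apply: hdom; apply/map_f; rewrite mem_enum.
have /choice [c hcj] : forall j, exists c, f (b j) = hp c by move=> j; apply: rat_residue (hb j).
exists (\row_j c j).
  apply/eqP => /rowP /(_ j0); rewrite !mxE => c0.
  have : f (b j0) = 1.
    rewrite -(rmorph1 f); congr (f _); apply: i_inj.
    by rewrite hb mulfV // !rmorph1.
  by rewrite hcj c0 rmorph0 => /eqP; rewrite eq_sym oner_eq0.
rewrite /lincomb; under eq_bigr do rewrite mxE /= -hcj -(ho _).1 -rmorphM.
rewrite -rmorph_sum -(rmorph0 f); congr (f _); apply: i_inj; rewrite rmorph0 rmorph_sum.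
under eq_bigr do rewrite rmorphM hb fmorph_div mulrAC.
by rewrite -mulr_suml -[X in X / _]/(lincomb _ (fun j => i (o j)) a) ha mul0r.
Qed.

(** Coordinates over the prime field, at most [d] of them, embed the residue field in a finite set;
    this injection provides both the finite structure and the cardinality. *)
Lemma residue_subfield_finite : exists (F : finFieldType) (g : {rmorphism F -> k}),
  (#|F| <= p ^ d)%N /\ forall o, K (i o) -> exists x, g x = f o.
Proof.
have [t [e' [td _ span]]] := @maximal_free_family _ _ hp (fun y => pF y) d
  residue_subfield_dependent.
have /choice [g hg] : forall y : residue_subfield, exists a, val y = lincomb hp e' a.
  by move=> y; have [a [ha _]] := span _ (valP y); exists a.
have gK : pcancel g (fun a => insub (lincomb hp e' a) : option residue_subfield).
  by move=> y; rewrite -hg valK.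
pose T : countType := HB.pack_for countType residue_subfield (PCanIsCountable gK).
have gK' : @pcancel 'rV['F_p]_t T g (fun a => insub (lincomb hp e' a)) by exact: gK.
pose F : finFieldType := HB.pack_for finFieldType residue_subfield
  (PCanIsCountable gK) (PCanIsFinite gK').
exists F, (val : {rmorphism residue_subfield -> k}); split.
  have := leq_card (g : F -> 'rV['F_p]_t) (pcan_inj gK).
  rewrite card_mx card_Fp // mul1n => /leq_trans; apply.
  by rewrite leq_exp2l // prime_gt1.
move=> o Ko; have ho : f o \in pF by apply/asboolP; exists o.
by exists (ResidueSubfield ho).
Qed.

End ResidueSubfield.

(** * The bound on the number of points *)

Section ColumnBound.
Variables (X : finType) (S : {set {set X * X}}).
Hypotheses (hS : association_scheme S) (hprim : primitive_scheme S).
Variables (F : finFieldType) (a : 'M[F]_#|X|).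
Local Notation c := (scheme_color S).
Let hc := scheme_coloring hS.
Hypotheses (ca : coherent c a) (ra : (1 < \rank a)%N).

Definition proportional_columns (i j : 'I_#|X|) :=
  [exists t, (t != 0) && [forall z, a z i == t * a z j]].

Lemma proportional_columnsP i j :
  reflect (exists2 t, t != 0 & forall z, a z i = t * a z j) (proportional_columns i j).
Proof.
apply: (iffP existsP) => [[t /andP[t0 /forallP h]]|[t t0 h]].
  by exists t => // z; apply/eqP.
by exists t; rewrite t0; apply/forallP => z; rewrite h.
Qed.

(* Whether [a z i = t * a z j] for all [z] only depends on which pairs
   [(c i z, c z j)] occur, hence on the color of [(i, j)]. *)
Lemma proportional_columns_color i j i' j' :
  c i j = c i' j' -> proportional_columns i j -> proportional_columns i' j'.
Proof.
move=> h /proportional_columnsP [t t0 ht]; apply/proportional_columnsP; exists t => // z'.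
have := coloring_regular hc (c i' z') (c z' j') h.
set A := [set l | _ ]; set B := [set l | _] => hAB.
have : (0 < #|A|)%N by rewrite hAB card_gt0; apply/set0Pn; exists z'; rewrite inE !eqxx.
rewrite card_gt0 => /set0Pn [z]; rewrite inE => /andP[/eqP h1 /eqP h2].
rewrite (ca (i := z') (j := i') (i' := z) (j' := i)); last first.
  by rewrite !(coloring_tr hc _ z') !(coloring_tr hc _ z) h1.
by rewrite ht; congr (_ * _); apply: ca.
Qed.

Lemma proportional_columns_equiv :
  equivalence_rel (fun x y => proportional_columns (enum_rank x) (enum_rank y)).
Proof.
move=> x y z; split; first by apply/proportional_columnsP; exists 1;
  rewrite ?oner_neq0 // => w; rewrite mul1r.
move=> /proportional_columnsP [t t0 ht].
apply/proportional_columnsP/proportional_columnsP => -[s s0 hs].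
  exists (s / t); first by rewrite mulf_neq0 ?invr_neq0.
  by move=> w; apply: (mulfI t0); rewrite -ht hs mulrA mulrCA mulfV ?mulr1.
by exists (t * s); rewrite ?mulf_neq0 // => w; rewrite ht hs mulrA.
Qed.

(** Every color occurs in every row, hence by transposition in every column, so all columns of [a]
    have the same set of entries. *)
Lemma column_neq0 i : exists z, a z i != 0.
Proof.
apply: contrapT => hn; have : a != 0.
  by rewrite -mxrank_eq0 -lt0n; apply: leq_trans ra.
move=> /eqP; apply; apply/matrixP => x y; rewrite mxE.
have [Sc _] := scheme_color_mem hS y x.
have : (0 < #|[set l | c i l == c y x]|)%N.
  by rewrite (card_color_row hS i Sc) (valency_gt0 hS Sc).
rewrite card_gt0 => /set0Pn [l]; rewrite inE => /eqP h.
rewrite (ca (i := x) (j := y) (i' := l) (j' := i)); last first.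
  by rewrite (coloring_tr hc y x) (coloring_tr hc i l) h.
by apply: contrapT => /eqP h0; apply: hn; exists l.
Qed.

Lemma proportional_columns_diag i j : proportional_columns i j -> i = j.
Proof.
pose E := [set u : X * X | proportional_columns (enum_rank u.1) (enum_rank u.2)].
have EU : E \in unions S.
  apply/imsetP; exists [set s in S | s \subset E]%SET.
    by rewrite powersetE; apply/fintype.subsetP => s; rewrite inE => /andP[].
  apply/setP => -[x y]; apply/idP/bigcupP => [hxy|[s]];
    last by rewrite inE => /andP[_ /fintype.subsetP]; apply.
  have [Sc mc] := scheme_color_mem hS (enum_rank x) (enum_rank y); rewrite !enum_rankK in mc.
  exists (c (enum_rank x) (enum_rank y)) => //; rewrite inE Sc;
    apply/fintype.subsetP => -[x' y'] hxy'.
  rewrite !inE /= in hxy *; apply: proportional_columns_color hxy.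
  by apply/esym/eqP; rewrite -(scheme_colorE hS) // !enum_rankK.
have Eeq : equivalence_rel (fun x y => (x, y) \in E).
  by move=> x y z; rewrite !inE; apply: proportional_columns_equiv.
move=> hij; case: (hprim) => _ /(_ E EU Eeq) [E1|ET].
  have : (enum_val i, enum_val j) \in E by rewrite inE !enum_valK.
  by rewrite E1 inE => /eqP /enum_val_inj.
(* In the remaining case all columns are multiples of column [i], against the rank hypothesis. *)
have full k l : proportional_columns k l.
  have : (enum_val k, enum_val l) \in E by rewrite ET inE.
  by rewrite inE !enum_valK.
have /choice [t ht] : forall k, exists t, forall z, a z k = t * a z i.
  by move=> k; have /proportional_columnsP [t _ ht] := full k i; exists t.
have : a = col i a *m (\row_k t k).
  by apply/matrixP => z k; rewrite !mxE big_ord1 !mxE ht mulrC.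
move=> h; move: ra; rewrite h ltnNge (leq_trans (mxrankM_maxl _ _)) //.
exact: rank_leq_col.
Qed.

(** Factor [a = U W] with [W] having [\rank a] rows. The nonzero multiples of the columns of [W] are
    pairwise distinct nonzero vectors. *)
Lemma coherent_column_bound : (#|X| * #|F|.-1 <= (#|F| ^ \rank a).-1)%N.
Proof.
have ha : col_base a *m row_base a = a by apply: mulmx_base.
move: (col_base a) (row_base a) ha => U W UW.
pose g (it : 'I_#|X| * F) : 'cV[F]_(\rank a) := it.2 *: col it.1 W.
have Ucol i : U *m col i W = col i a.
  by rewrite -[in RHS]UW; apply/matrixP => x y; rewrite !mxE; apply: eq_bigr => l _; rewrite !mxE.
have W0 i : col i W != 0.
  have [z az] := column_neq0 i; apply: contra az => /eqP h.
  by have := congr1 (fun M : 'cV_#|X| => M z 0) (Ucol i); rewrite h mulmx0 !mxE => <-.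
have ginj : {in finset.setX [set: 'I_#|X|] [set~ (0 : F)] &, injective g}.
  move=> [i t] [j s]; rewrite !inE /= => t0 s0 hg.
  have ij : i = j.
    apply: proportional_columns_diag; apply/proportional_columnsP.
    exists (t^-1 * s); first by rewrite mulf_neq0 ?invr_neq0.
    move=> z; have := congr1 (fun M => (U *m M) z 0) hg.
    rewrite /g /= -!scalemxAr !Ucol !mxE => h.
    by apply: (mulfI t0); rewrite h !mulrA mulfV // mul1r.
  subst j; congr pair; move/eqP: hg; rewrite /g /= -subr_eq0 -scalerBl scaler_eq0.
  by rewrite (negPf (W0 i)) orbF subr_eq0 => /eqP.
have := card_in_imset ginj; rewrite cardsX cardsT card_ord cardsC1 => <-.
have -> : (#|F| ^ \rank a).-1 = #|[set~ (0 : 'cV[F]_(\rank a))]| by rewrite cardsC1 card_mx muln1.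
apply/subset_leq_card/fintype.subsetP => _ /imsetP [[i t] hit ->].
by move: hit; rewrite !inE /= => t0; rewrite scaler_eq0 negb_or t0 W0.
Qed.

End ColumnBound.

(** * Integrality of the Frame number *)

Section FrameIntegrality.
Variables (C : numClosedFieldType) (V : set C) (p : nat).
Hypotheses (p_prime : prime p) (hV : valuation_ring V) (Vp : ~ V (p%:R)^-1).

Let p0 : p%:R != 0 :> C. Proof. by rewrite pnatr_eq0 -lt0n prime_gt0. Qed.

Lemma prime_bezout (z : int) : ~~ (p %| `|z|)%N -> exists u v : int, u * z + v * p%:Z = 1.
Proof.
move=> h; have : coprimez z p%:Z by rewrite /coprimez /gcdz /= -[_ == _]/(coprime _ _)
  coprime_sym prime_coprime.
by move=> /coprimezP [[u v] /= huv]; exists u, v.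
Qed.

Lemma valuation_int_dvd (z : int) : V (z%:~R / p%:R) -> (p %| `|z|)%N.
Proof.
move=> hz; apply: contraT => /prime_bezout [u [v huv]]; exfalso; apply: Vp.
have -> : (p%:R)^-1 = u%:~R * (z%:~R / p%:R) + v%:~R :> C.
  apply: (mulIf p0); rewrite mulVf // mulrDl -mulrA divfK //.
  by rewrite -[p%:R]/(p%:Z%:~R) -!rmorphM -rmorphD huv.
apply: (subringD hV); last exact: (subring_int hV).
by apply: (subringM hV) => //; apply: (subring_int hV).
Qed.

Lemma valuation_int_unit (z : int) : ~~ (p %| `|z|)%N -> V (z%:~R)^-1.
Proof.
move=> hz; have [u [v huv]] := prime_bezout hz.
have z0 : z%:~R != 0 :> C by rewrite intr_eq0; apply: contraNneq hz => ->; rewrite dvdn0.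
case: (valuation_total hV (z%:~R / p%:R)) => [/valuation_int_dvd|]; first by rewrite (negPf hz).
rewrite invf_div => hpz; have -> : (z%:~R)^-1 = u%:~R + v%:~R * (p%:R / z%:~R) :> C.
  apply: (mulIf z0); rewrite mulVf // mulrDl -mulrA divfK //.
  by rewrite -[p%:R]/(p%:Z%:~R) -!rmorphM -rmorphD huv.
apply: (subringD hV); first exact: (subring_int hV).
by apply: (subringM hV) => //; apply: (subring_int hV).
Qed.

End FrameIntegrality.

(** The hypothesis of the theorem says that the Frame number is not [p] times an integer;
    integrality turns this into invertibility in V. Each prime [l] of the denominator is excluded
    with a valuation ring for [l]. *)
Lemma frame_number_int (C : numClosedFieldType) (X : finType) (S : {set {set X * X}}) :
  association_scheme S -> exists z : int, frame_number C S = z%:~R.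
Proof.
move=> hS; set Fr := frame_number C S; exists (numq Fr).
suff d1 : denq Fr = 1 by rewrite -[LHS]divq_num_den d1 divr1.
apply/eqP; rewrite -[denq Fr]absz_denq; apply: contraT => d1.
pose l := pdiv `|denq Fr|; have l_prime : prime l.
  by apply: pdiv_prime; rewrite ltn_neqAle eq_sym absz_gt0 denq_eq0 andbT.
have ld : (l %| `|denq Fr|)%N by apply: pdiv_dvd.
have [V hV Vl] := valuation_ring_exists C l_prime.
have [VFr _] := frame_number_valuation hS hV.
have ln : (l %| `|numq Fr|)%N.
  apply: (valuation_int_dvd l_prime hV Vl).
  have /dvdnP [m hm] := ld.
  have -> : (numq Fr)%:~R / l%:R = ratr Fr * m%:R :> C.
    have l0 : l%:R != 0 :> C by rewrite pnatr_eq0 -lt0n prime_gt0.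
    apply: (mulIf l0); rewrite divfK // -mulrA -natrM -hm.
    rewrite -(ratr_nat C) -rmorphM -(ratr_int C); congr ratr.
    by rewrite numqE -[denq Fr in LHS]absz_denq.
  by apply: (subringM hV) => //; apply: (subring_nat hV).
have : (l %| gcdn `|numq Fr| `|denq Fr|)%N by rewrite dvdn_gcd ln ld.
by rewrite (eqP (coprime_num_den Fr)) dvdn1 => /eqP l1; have := prime_gt1 l_prime; rewrite l1.
Qed.

(** A positive value is not the default 0 of [xget], so it comes from an actual idempotent. *)
Lemma min_multiplicity_attained (C : numClosedFieldType) (X : finType) (S : {set {set X * X}}) :
  (0 < min_multiplicity C S)%N ->
  exists2 P : 'M[C]_#|X|, central_primitive_idempotents S P & multiplicity S P =
    min_multiplicity C S.
Proof.
rewrite /min_multiplicity; case: xgetP => // m _ [[P [hP _] <-] _] _.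
by exists P.
Qed.

(** * Reduction of a block to a finite field *)

Section Reduction.
Variables (X : finType) (S : {set {set X * X}}) (hS : association_scheme S).
Variables (C : numClosedFieldType) (V : set C) (hV : valuation_ring V).
Local Notation N := #|X|.
Local Notation c := (scheme_color S).
Let hc := scheme_coloring hS.
Variables (P e : 'M[C]_N) (n : nat) (u v : 'I_n -> 'M[C]_N).
Hypotheses (hP : coherent_primitive c P) (hmu : matrix_units c V P e u v).
Hypothesis uvV : forall i j a b, V ((u i *m v j) a b).
Variables (O : comNzRingType) (i : {rmorphism O -> C}) (k : fieldType) (f : {rmorphism O -> k}).
Hypotheses (i_inj : injective i) (iV : forall x, V x <-> exists o, i o = x)
  (f_unit : forall o, f o != 0 -> exists o', o' * o = 1).
Variables (F : finFieldType) (g : {rmorphism F -> k}).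
Hypothesis Pg : forall o a b, i o = P a b -> exists x, g x = f o.

Lemma reduction_rank : exists2 a : 'M[F]_N, coherent c a & \rank a = \rank e.
Proof.
have [[cP zP PP] P0 _] := hP.
have /choice [Y hY] : forall w : ('I_n * 'I_n) * ('I_N * 'I_N), exists o,
    i o = (u w.1.1 *m v w.1.2) w.2.1 w.2.2 by move=> w; apply/iV.
pose E' a b : 'M[O]_N := \matrix_(x, y) Y ((a, b), (x, y)).
have iE a b : map_mx i (E' a b) = u a *m v b.
  by apply/matrixP => x y; rewrite !mxE hY mxE.
pose E a b := map_mx f (E' a b).
have imap m1 m2 (M M' : 'M[O]_(m1, m2)) : map_mx i M = map_mx i M' -> M = M'.
  by move=> h; apply/matrixP => x y; apply: i_inj;
    have := congr1 (fun B : 'M_(m1, m2) => B x y) h; rewrite !mxE.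
have EE' a b a' b' : E' a b *m E' a' b' = (b == a')%:R *: E' a b'.
  apply: imap; rewrite map_mxM map_mxZ !iE rmorph_nat.
  rewrite mulmxA -(mulmxA (u a)) (mu_vu hmu) -scalemxAr -scalemxAl (mu_ue hmu) //.
have EE a b a' b' : E a b *m E a' b' = (b == a')%:R *: E a b'.
  by rewrite -map_mxM EE' map_mxZ rmorph_nat.
have cE' a b : coherent c (E' a b).
  move=> x y x' y' h; apply: i_inj; have cuv : coherent c (u a *m v b).
    by apply: (coherent_mul hc); [apply: (mu_u hmu)|apply: (mu_v hmu)].
  by have := cuv x y x' y' h; rewrite -iE !mxE.
have [i0 _] : exists i0 : 'I_n, true.
  case: (n) u v hmu => [|n'] u' v' hmu'; last by exists ord0.
  by case/eqP: P0; rewrite -(mu_sum hmu') big_ord0.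
(* Reduction cannot increase the rank of the idempotent or of its complement; as the two ranks add
   up to [N], neither drops. *)
have rE0 : \rank (E i0 i0) = \rank e.
  have uv_idem : u i0 *m v i0 *m (u i0 *m v i0) = u i0 *m v i0.
    by rewrite -iE -map_mxM EE' eqxx scale1r.
  have ruv : \rank (u i0 *m v i0) = \rank e.
    apply/eqP; rewrite -(eqr_nat C) -(mxtrace_idempotent uv_idem).
    by rewrite (mu_trace hmu) eqxx mul1r.
  have ruv' : \rank (1%:M - u i0 *m v i0)%R = (N - \rank e)%N.
    have idem' : (1%:M - u i0 *m v i0) *m (1%:M - u i0 *m v i0) = 1%:M - u i0 *m v i0.
      by rewrite mulmxBl !mulmxBr !mul1mx !mulmx1 uv_idem subrr subr0.
    apply/eqP; rewrite -(eqr_nat C) -(mxtrace_idempotent idem') linearB /= mxtrace1.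
    by rewrite (mxtrace_idempotent uv_idem) ruv natrB // rank_leq_row.
  apply/eqP; rewrite eqn_leq -{1}ruv -iE mxrank_reduction //=.
  have h1 : (\rank (1%:M - E i0 i0)%R <= N - \rank e)%N.
    have -> : 1%:M - E i0 i0 = map_mx f (1%:M - E' i0 i0) by rewrite map_mxB map_mx1.
    by rewrite (leq_trans (mxrank_reduction i f_unit _)) // map_mxB map_mx1 iE ruv'.
  have h2 : (N <= \rank (E i0 i0) + \rank (1%:M - E i0 i0)%R)%N.
    rewrite -[leqLHS](mxrank1 k); have := mxrank_add (E i0 i0) (1%:M - E i0 i0).
    by rewrite addrC subrK.
  have h3 : (\rank e <= N)%N by apply: rank_leq_row.
  have h4 := leq_trans h2 (leq_add (leqnn _) h1).
  by rewrite -(leq_add2r (N - \rank e)) subnKC.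
have E0 : E i0 i0 != 0 by rewrite -mxrank_eq0 rE0 mxrank_eq0 (mu_e0 hmu).
pose P' := \sum_a E' a a.
have iP' : map_mx i P' = P.
  rewrite map_mx_sum -(mu_sum hmu); by apply: eq_bigr => a _.
pose Pk := map_mx f P'.
(* The units reduce only to [k], but by [Pg] the entries of their sum [P'] reduce into [F]. *)
have /choice [Q hQ] : forall w : 'I_N * 'I_N, exists x, g x = f (P' w.1 w.2).
  by move=> w; apply: (Pg (a := w.1) (b := w.2)); rewrite -iP' mxE.
pose PF : 'M[F]_N := \matrix_(x, y) Q (x, y).
have gPF : map_mx g PF = Pk by apply/matrixP => x y; rewrite !mxE hQ.
have cP' : coherent c P' by apply: coherent_sum => a _.
have cPF : coherent c PF.
  move=> x y x' y' h; apply: (fmorph_inj g); have := coherent_map f cP' h.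
  by rewrite -[map_mx f P']gPF !mxE.
have PkPk : Pk *m Pk = Pk.
  by rewrite -map_mxM; congr (map_mx f _); apply: imap; rewrite map_mxM iP'.
have PFPF : PF *m PF = PF.
  by apply: (map_mx_inj (f := g)); rewrite map_mxM gPF.
have PkE a b : Pk *m E a b = E a b.
  rewrite -map_mxM; congr (map_mx f _); rewrite mulmx_suml (bigD1 a) //= big1 => [|l /negPf la].
    by rewrite addr0 EE' eqxx scale1r.
  by rewrite EE' la scale0r.
pose B := [set a : 'M[F]_N | `[< coherent c a >] && (PF *m a == a)].
have BP x : reflect (coherent c x /\ PF *m x = x) (x \in B).
  by rewrite inE; apply: (iffP andP) => [[/asboolP ? /eqP ?]|[? ?]]; split=> //;
    [apply/asboolP|apply/eqP].
have BB x y : x \in B -> y \in B -> x - y \in B.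
  move=> /BP [cx Px] /BP [cy Py]; apply/BP; split; first exact: coherentB.
  by rewrite mulmxBr Px Py.
have BM x y : x \in B -> y \in B -> x *m y \in B.
  move=> /BP [cx Px] /BP [cy Py]; apply/BP; split; first exact: (coherent_mul hc).
  by rewrite mulmxA Px.
have colormx_map (R1 R2 : pzRingType) (h : {rmorphism R1 ->
  R2}) s : map_mx h (colormx c R1 s) = colormx c R2 s.
  by apply/matrixP => x y; rewrite !mxE rmorph_nat.
have bB s : PF *m colormx c F s \in B.
  apply/BP; split; last by rewrite mulmxA PFPF.
  by apply: (coherent_mul hc) => //; apply: coherent_colormx.
have EB a b : exists cf : 'M[F]_N -> k, E a b = \sum_(x in B) cf x *: map_mx g x.
  have cE : coherent c (E a b) by apply: coherent_map.
  (* Distinct [s] may give the same element of [B], so coefficients are summed over each fiber. *)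
  exists (fun x => \sum_(s | PF *m colormx c F s == x) colorcoef c (E a b) s).
  rewrite -[LHS]PkE {1}(coherent_sum_colormx cE) mulmx_sumr.
  rewrite (partition_big (fun s => PF *m colormx c F s) (mem B)) //=.
  apply: eq_bigr => x _; rewrite scaler_suml; apply: eq_bigr => s /eqP <-.
  by rewrite -scalemxAr map_mxM gPF colormx_map.
(* By [mu_integral] the coordinates lie in V, so the expansion holds over [O] and can be reduced. *)
have PA s : exists M : 'M[O]_n, P' *m colormx c O s = \sum_a \sum_b M a b *: E' a b.
  have /choice [x hx] : forall ab : 'I_n * 'I_n, exists o,
      v ab.1 *m colormx c C s *m u ab.2 = i o *: e.
    move=> [a b]; have [y Vy hy] := mu_integral hmu s a b.
    by have [o ho] := (iV y).1 Vy; exists o; rewrite ho.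
  exists (\matrix_(a, b) x (a, b)); apply: imap.
  rewrite map_mxM iP' colormx_map map_mx_sum.
  have -> : P *m colormx c C s = P *m colormx c C s *m P.
    by rewrite -mulmxA -zP ?mulmxA ?PP //; apply: coherent_colormx.
  rewrite -(mu_sum hmu) !mulmx_suml; apply: eq_bigr => a _.
  rewrite mulmx_sumr map_mx_sum; apply: eq_bigr => b _.
  rewrite map_mxZ iE !mulmxA -(mulmxA (u a) _ (colormx _ _ _)) -(mulmxA (u a)) (hx (a, b)) mxE.
  by rewrite -scalemxAr -scalemxAl (mu_ue hmu).
have BE b : b \in B -> exists M : 'M[k]_n, map_mx g b = \sum_i \sum_j M i j *: E i j.
  move=> /BP [cb Pb]; have /choice [M hM] := PA.
  have cgb : coherent c (map_mx g b) by apply: coherent_map.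
  exists (\sum_s colorcoef c (map_mx g b) s *: map_mx f (M s)).
  rewrite -{1}Pb map_mxM gPF {1}(coherent_sum_colormx cgb) mulmx_sumr.
  transitivity (\sum_s \sum_x \sum_y (colorcoef c (map_mx g b) s * f (M s x y)) *: E x y).
    apply: eq_bigr => s _;
      rewrite -scalemxAr -(colormx_map _ _ f) -map_mxM hM map_mx_sum scaler_sumr.
    apply: eq_bigr => x _; rewrite map_mx_sum scaler_sumr; apply: eq_bigr => y _.
    by rewrite map_mxZ scalerA.
  rewrite exchange_big; apply: eq_bigr => x _; rewrite exchange_big; apply: eq_bigr => y _ /=.
  by rewrite summxE scaler_suml; apply: eq_bigr => s _; rewrite !mxE.
have [a Ba ra] := finite_algebra_primitive_idempotent BB BM EE E0 EB BE.
by exists a; [case/BP: Ba|rewrite ra].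
Qed.

End Reduction.

(** The residue field has only at most [q] elements; the quotient, being the sum of the powers of
    [Q] below [m], is monotone in [Q]. *)
Lemma geometric_bound (N Q q m : nat) : (1 < Q)%N -> (Q <= q)%N ->
  (N * Q.-1 <= (Q ^ m).-1)%N -> N%:R <= ((q%:R : rat) ^+ m - 1) / (q%:R - 1).
Proof.
move=> Q1 Qq h; have q1 : (1 < q)%N := leq_trans Q1 Qq.
have q0 : (0 : rat) < q%:R - 1 by rewrite subr_gt0 ltr1n.
rewrite subrX1 mulrAC mulfV ?gt_eqF // mul1r.
have : (N <= \sum_(j < m) Q ^ j)%N.
  by move: h; rewrite predn_exp mulnC leq_pmul2l // -subn1 subn_gt0.
rewrite -(ler_nat rat) => /le_trans; apply; rewrite natr_sum; apply: ler_sum => j _.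
by rewrite natrX lerXn2r ?nnegrE ?ler0n // ler_nat.
Qed.

Lemma primitive_scheme_bound (C : numClosedFieldType) (X : finType) (S :
  {set {set X * X}}) (p : nat) :
  association_scheme S -> primitive_scheme S -> prime p ->
  (~ exists z : int, frame_number C S = p%:R * z%:~R) ->
  (1 < min_multiplicity C S)%N ->
  #|X|%:R <= (((p ^ degree_over_rat (scheme_field C S))%N%:R : rat) ^+ min_multiplicity C S - 1) /
    ((p ^ degree_over_rat (scheme_field C S))%N%:R - 1).
Proof.
move=> hS hprim hp hFr hm.
have [P /(primitive_idempotentE hS) hP mP] := min_multiplicity_attained (ltnW hm).
have [V hV Vp] := valuation_ring_exists C hp.
have [_ /(_ P hP) [n [e [u [v [hmu huv]]]]]] := frame_number_valuation hS hV.
have [z hz] := frame_number_int C hS.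
have pz : ~~ (p %| `|z|)%N.
  apply/negP => pz; apply: hFr; have /dvdzP [w hw] : (p%:Z %| z)%Z by [].
  by exists w; rewrite hz hw rmorphM mulrC.
have {}huv : forall i j a b, V ((u i *m v j) a b).
  by apply: huv; rewrite hz ratr_int; apply: (valuation_int_unit hp).
have [O [i [k [f [i_inj iV _ f_unit]]]]] := residue_field_exists hV.
have [sK KV entK] := scheme_field_closed C S.
have [eb hb] := scheme_field_finite_degree C hS.
have [F [g [cardF gF]]] := residue_subfield_finite hp hV Vp i_inj iV f_unit sK KV hb.
have [a ca ra] : exists2 a : 'M[F]_#|X|, coherent (scheme_color S) a & \rank a = \rank e.
  apply: (reduction_rank hS hP hmu huv i_inj iV f_unit (g := g)) => o x y ho.
  apply: gF; rewrite ho; apply: entK; exact/(primitive_idempotentE hS).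
have re : \rank e = min_multiplicity C S by rewrite -mP (multiplicityE hS hmu hP).
have ra1 : (1 < \rank a)%N by rewrite ra re.
apply: (geometric_bound (Q := #|F|)) => //; first exact: finNzRing_gt1.
by rewrite -re -ra; apply: (coherent_column_bound hS hprim ca ra1).
Qed.

Local Open Scope complex_scope.

Theorem theorem1p3 (R : realType) (X : finType) (S : {set {set X * X}}) (p : nat)
    (hS : association_scheme S) (hprim : primitive_scheme S)
    (hp : prime p)
    (hFr : ~ exists k : int, frame_number R[i] S = p%:R * k%:~R)
    (hm : (1 < min_multiplicity R[i] S)%N) :
  let m := min_multiplicity R[i] S in
  let q : rat := (p ^ degree_over_rat (scheme_field R[i] S))%N%:R in
  #|X|%:R <= (q ^+ m - 1) / (q - 1).
Proof.
exact: primitive_scheme_bound.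
Qed.
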